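(* Let $p$ be a prime, $G$ a finite group, $\mathfrak{F}$ a formation containing the class $\mathfrak{N}_p$ of all finite $p$-nilpotent groups and satisfying $\mathfrak{G}_{p'}\mathfrak{F}=\mathfrak{F}$, and $E$ a normal subgroup of $G$ with $G/E\in\mathfrak{F}$. Suppose that for any Sylow $p$-subgroup $P$ of $E$, $N_G(P)\in\mathfrak{N}_p$ and either every maximal subgroup of $P$ satisfies partial $\Pi$-property in $G$, or every cyclic subgroup of $P$ of prime order or of order $4$ (the latter only when $P$ is not quaternion-free) satisfies partial $\Pi$-property in $G$. Then $G\in\mathfrak{F}$.
   Context: All groups are finite. For a positive integer $n$ and a set of primes $\pi$, $n$ is a $\pi$-number if all its prime divisors lie in $\pi$ (so $1$ is a $\pi$-number for every $\pi$, including $\pi=\emptyset$); $\pi(H)$ is the set of prime divisors of $|H|$. Partial $\Pi$-property: a subgroup $H$ of $G$ satisfies partial $\Pi$-property in $G$ if there exists a chief series $1=G_0<G_1<\cdots<G_n=G$ of $G$ such that for every $1\leq i\leq n$, the index $|G/G_{i-1}:N_{G/G_{i-1}}(HG_{i-1}/G_{i-1}\cap G_i/G_{i-1})|$ is a $\pi(HG_{i-1}/G_{i-1}\cap G_i/G_{i-1})$-number. A group is quaternion-free if it has no section isomorphic to the quaternion group of order $8$; thus the condition on cyclic subgroups of order $4$ is imposed only when $p=2$ and $P$ is not quaternion-free. A formation is a class of groups closed under homomorphic images and subdirect products. $\mathfrak{G}_{p'}$ is the class of all finite $p'$-groups, and $\mathfrak{G}_{p'}\mathfrak{F}$ is the class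 of groups $G$ having a normal $p'$-subgroup $N$ with $G/N\in\mathfrak{F}$. *)

(* Defs.v *)
From mathcomp Require Import all_boot all_fingroup all_solvable.

Set Implicit Arguments.
Unset Strict Implicit.
Unset Printing Implicit Defensive.

Import GroupScope.

Definition group_class := forall gT : finGroupType, {group gT} -> Prop.

Definition class_sub (X Y : group_class) : Prop :=
  forall (gT : finGroupType) (G : {group gT}), X gT G -> Y gT G.

Definition class_eq (X Y : group_class) : Prop :=
  forall (gT : finGroupType) (G : {group gT}), X gT G <-> Y gT G.

Definition class_mul (X Y : group_class) : group_class :=
  fun gT G => exists N : {group gT}, [/\ N <| G, X gT N & Y _ (G / N)%G].

(* This includes closure under isomorphism, as f may be injective. *)
Definition morphim_closed (X : group_class) : Prop :=
  forall (gT rT : finGroupType) (G : {group gT}) (f : {morphism G >-> rT}),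
    X gT G -> X rT (f @* G)%G.

(* Closure under subdirect products of any positive finite number of factors
   follows from the binary case by induction, together with morphim_closed. *)
Definition subdirect_closed (X : group_class) : Prop :=
  forall (gT1 gT2 : finGroupType) (D : {group gT1 * gT2}),
    X gT1 ([morphism of fst] @* D)%G -> X gT2 ([morphism of snd] @* D)%G ->
    X _ D.

Definition formation (X : group_class) : Prop :=
  morphim_closed X /\ subdirect_closed X.

Definition p'_groups (p : nat) : group_class := fun gT G => p^'.-group G.

Definition p_nilpotent (p : nat) : group_class :=
  fun gT G => exists K : {group gT}, K <| G /\ p^'.-Hall(G) K.

Definition quaternion_free (gT : finGroupType) (P : {group gT}) : Prop :=
  forall A B : {group gT}, A \subset P -> B <| A -> ~~ (A / B \isog 'Q_8).

(* The chief series is 1 :: s; U and V are its terms of index i and i + 1. *)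
Definition partial_Pi (gT : finGroupType) (G H : {group gT}) : Prop :=
  exists s : seq {group gT},
    [/\ (G.-chief).-series 1%G s, last 1%G s = G
      & forall i, i < size s ->
          let U := nth 1%G (1%G :: s) i in
          let V := nth 1%G s i in
          let K := (H * U) / U :&: V / U in
          (\pi(K)).-nat #|G / U : 'N_(G / U)(K)|].

(* Main.v *)
Require Import Defs.
From mathcomp Require Import all_boot all_fingroup all_solvable.
From mathcomp Require ssralg finalg.

(* It suffices that E is p-nilpotent: then E = O_p'(E) P, the Frattini argument
   gives G = O_p'(E) N_G(P), so G is p-nilpotent and lies in F.

   A p-subgroup with nontrivial trace on a chief factor V/U and normalizer of
   p-power index forces V/U to be a p-group. As N_E(P) = P C_E(P), an E-normal
   section of order p is central in E. With O_p'(E) = 1 and maximal subgroups,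
   each M gives a normal p-subgroup W with [W, E] in M; by induction on |E| one
   may take W minimal normal with E/W p-nilpotent and [W, E] in Phi(P), and a
   Frattini argument on a p-complement of O_{p,p'}(E) concludes.

   For subgroups of order p or 4, let O be generated by the p'-elements of E and
   K be minimal among the normal subgroups of G in E not centralizing O, with
   N = C_K(O). If K is not a p-group, it is perfect and its elements of order p
   (and 4) lie in N, which is central in K, contradicting Frobenius' criterion.
   If K is a p-group, then K = [K, O] has exponent p (or 4, when it has a Q_8
   section), so some element of order p or 4 is central in S/N for a Sylow
   subgroup S of G, which makes K/N of order p, hence central. *)

Set Implicit Arguments.
Unset Strict Implicit.
Unset Printing Implicit Defensive.

Import GroupScope.

(** * Coprime action and quaternion sections *)

(** [A] acts trivially on [X / [~: X, A]], and coprime action lifts fixed points from this quotient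
    to [X]. *)
Lemma coprime_comm_cent_mul (gT : finGroupType) (A X : {group gT}) :
  A \subset 'N(X) -> coprime #|X| #|A| -> solvable X ->
  [~: X, A] * 'C_X(A) = X.
Proof.
move=> nXA coXA solX.
have sRX: [~: X, A] \subset X by rewrite commg_subl.
have nRX : X \subset 'N([~: X, A]) by rewrite commg_norml.
have nRA : A \subset 'N([~: X, A]) by rewrite commg_normr.
apply/eqP; rewrite eqEsubset mul_subG ?subsetIl //=.
rewrite -quotientSK // coprime_quotient_cent //= subsetI subxx /=.
by rewrite quotient_cents2r.
Qed.

Lemma coprime_comm_centralized (gT : finGroupType) (A X : {group gT}) :
  A \subset 'N(X) -> coprime #|X| #|A| -> solvable X ->
  A \subset 'C([~: X, A]) -> A \subset 'C(X).
Proof.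
move=> nXA coXA solX cRA; rewrite centsC.
rewrite -{1}(coprime_comm_cent_mul nXA coXA solX).
by rewrite mul_subG ?subsetIr // centsC.
Qed.

(** The n-th power map is an endomorphism of [X]. Its kernel contains each [[~ x, a] = x^-1 * x ^
    a], because [a] fixes [x ^+ n]; hence it contains [[~: X, A] = X]. *)
Lemma expg_hom_trivial (gT : finGroupType) (A X : {group gT}) n :
  A \subset 'N(X) -> [~: X, A] = X ->
  {in X &, forall x y, (x * y) ^+ n = x ^+ n * y ^+ n} ->
  {in X, forall x, A \subset 'C[x ^+ n]} ->
  {in X, forall x, x ^+ n = 1}.
Proof.
move=> nXA XAX homX cXA.
have gK : group_set [set x in X | x ^+ n == 1].
  apply/group_setP; split=> [|x y]; first by rewrite inE group1 expg1n eqxx.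
  rewrite !inE => /andP[Xx /eqP xn] /andP[Xy /eqP yn].
  by rewrite groupM //= homX // xn yn mulg1 eqxx.
suff /subsetP sXK : X \subset Group gK.
  by move=> x /sXK; rewrite inE => /andP[_ /eqP].
suff: [~: X, A] \subset Group gK by rewrite XAX.
rewrite gen_subG; apply/subsetP=> _ /imset2P[x a Xx Aa ->].
have Xxa : x ^ a \in X by rewrite memJ_norm ?(subsetP nXA).
have /cent1P cxa := subsetP (cXA x Xx) a Aa.
have xan : (x ^ a) ^+ n = x ^+ n by rewrite -conjXg conjgE -cxa mulKg.
by rewrite inE commgEl groupM ?groupV //= homX ?groupV // expgVn xan mulVg.
Qed.

Lemma Phi_pX (gT : finGroupType) (p : nat) (X : {group gT}) :
  p.-group X -> {in X, forall x, x ^+ p \in 'Phi(X)}.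
Proof.
move=> pX x Xx; rewrite (Phi_joing pX) mem_gen // inE.
by apply/orP; right; rewrite -{1}(expn1 p) Mho_p_elt // (mem_p_elt pX).
Qed.

Lemma Phi_der1 (gT : finGroupType) (p : nat) (X : {group gT}) :
  p.-group X -> X^`(1) \subset 'Phi(X).
Proof. by move=> pX; rewrite (Phi_joing pX) joing_subl. Qed.

Lemma expg2_abelian (gT : finGroupType) (X : {group gT}) :
  {in X, forall x, x ^+ 2 = 1} -> abelian X.
Proof.
move=> X2; have XV x : x \in X -> x^-1 = x.
  by move=> Xx; apply: (mulIg x); rewrite mulVg -expg2 X2.
apply/centsP=> x Xx y Xy.
by rewrite /commute -[LHS]XV ?groupM // invMg !XV.
Qed.

(** The relations make the generated group an image of ['Q_8]; being nonabelian, it cannot have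
    order dividing 4. *)
Lemma isog_Q8 (gT : finGroupType) (x y : gT) :
  x ^+ 4 = 1 -> y ^+ 2 = x ^+ 2 -> x ^ y = x^-1 -> ~ commute x y ->
  <[x]> <*> <[y]> \isog [set: 'Q_8].
Proof.
move=> x4 y2 xy ncxy; set D := <[x]> <*> <[y]>.
have homD : D \homg [set: 'Q_(2 ^ 3)].
  rewrite (Grp_quaternion (isT : 2 < 3)); apply/existsP; exists (x, y) => /=.
  by rewrite !xpair_eqE /= x4 y2 xy !eqxx.
have oD : #|D| %| 2 ^ 3 by rewrite -(card_quaternion (isT : 2 < 3)) card_homg.
have nabD : ~~ abelian D.
  apply/negP=> /centsP abD; apply: ncxy.
  by apply: abD; rewrite mem_gen // inE cycle_id ?orbT.
apply/(isoGrpP _ (Grp_quaternion (isT : 2 < 3))).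
rewrite (card_quaternion (isT : 2 < 3)); split=> //; last first.
  by rewrite -(Grp_quaternion (isT : 2 < 3)).
have /(dvdn_pfactor _ _ (isT : prime 2)) [m lem oDm] := oD.
case: (ltnP 2 m) => [lt2m | lem2].
  by rewrite oDm; congr (2 ^ _)%N; apply/eqP; rewrite eqn_leq lem lt2m.
case/negP: nabD; apply: (@p2group_abelian _ 2).
  by rewrite /pgroup oDm pnatX pnat_id.
by rewrite oDm pfactorK.
Qed.

(* If the elements of order 4 commute pairwise, every element outside the
   subgroup B they generate inverts B, so |X : B| <= 2 and [X, A] \subset B. *)
Lemma Q8_subgroup (gT : finGroupType) (A X : {group gT}) :
  2.-group X -> A \subset 'N(X) -> [~: X, A] = X -> ~~ abelian X ->
  #|'Phi(X)| = 2 ->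
  exists2 D : {group gT}, D \subset X & D \isog [set: 'Q_8].
Proof.
move=> pX nXA XAX nabX oPhi.
(* Squares lie in ['Phi(X)], of order 2, so [T] consists of the elements of order 4. *)
pose T := [set x in X | x ^+ 2 != 1].
have sTX : T \subset X by apply/subsetP=> x; rewrite inE => /andP[].
have PhiE u v : u \in 'Phi(X) -> v \in 'Phi(X) -> u != 1 -> v != 1 -> u = v.
  have /card_le1_eqP PhiD1 : #|'Phi(X)^#| <= 1.
    by rewrite -ltnS -oPhi [in ltnRHS](cardsD1 1) group1.
  by move=> Pu Pv u1 v1; apply: PhiD1; rewrite !inE ?u1 ?v1.
(* For noncommuting [x] and [y] of order 4, [x ^+ 2], [y ^+ 2] and [[~ x, y]] all equal the
   involution of ['Phi(X)]: these are the relations of ['Q_8]. *)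
have [cTT | ] := boolP (T \subset 'C(T)); last first.
  case/subsetPn=> x Tx; rewrite -sub_cent1 => /subsetPn[y Ty /cent1P cxy].
  have ncxy : ~ commute x y by move/commute_sym.
  move: Tx Ty; rewrite !inE => /andP[Xx x2] /andP[Xy y2].
  have Px2 := Phi_pX pX Xx; have Py2 := Phi_pX pX Xy.
  have Pxy : [~ x, y] \in 'Phi(X).
    by rewrite (subsetP (Phi_der1 pX)) // mem_commg.
  have xy1 : [~ x, y] != 1.
    by apply/eqP=> /eqP/commgP/ncxy.
  have e1 := PhiE _ _ Py2 Px2 y2 x2; have e2 := PhiE _ _ Pxy Px2 xy1 x2.
  have x4 : x ^+ 4 = 1.
    have : #[x ^+ 2] %| 2 by rewrite -[n in _ %| n]oPhi order_dvdG.
    by rewrite order_dvdn -expgM => /eqP.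
  exists (<[x]> <*> <[y]>)%G; first by rewrite join_subG !cycle_subG Xx.
  apply: isog_Q8 => //.
  by rewrite conjg_mulR e2 -expgS; apply: (mulgI x); rewrite -expgS x4 mulgV.
case/negP: (nabX); pose B := <<T>>%G.
have abB : abelian B by rewrite abelian_gen.
have sBX : B \subset X by rewrite gen_subG.
have BT t : t \in X -> t \notin B -> t ^+ 2 = 1.
  move=> Xt; apply: contraNeq => t2.
  by rewrite mem_gen // inE Xt.
(* Both [x] and [x * t] lie outside [B], so both have trivial square, which forces [x] to invert
   [t]. *)
have invT t x : t \in T -> x \in X -> x \notin B -> t ^ x = t^-1.
  move=> Tt Xx Bx; have Bt : t \in B by rewrite mem_gen.
  have x2 := BT x Xx Bx.
  have xt2 : (x * t) ^+ 2 = 1.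
    by apply: BT; [rewrite groupM // (subsetP sTX) | rewrite groupMr].
  apply: (mulIg t); rewrite mulVg -xt2 expg2 conjgE.
  have -> : x^-1 = x by apply: (mulIg x); rewrite mulVg -x2 expg2.
  by rewrite !mulgA.
(* Otherwise [x], [y] and [x^-1 * y] all invert [T]. The last, a product of two inversions, also
   fixes [T] pointwise, so [T] is empty and [X] is abelian. *)
have BXX x y : x \in X -> y \in X -> x \notin B -> y \notin B -> x^-1 * y \in B.
  move=> Xx Xy Bx By; apply: contraR nabX => Bxy.
  have T0 t : t \notin T.
    apply/negP=> Tt; have := invT t _ Tt (groupM (groupVr Xx) Xy) Bxy.
    have -> : t ^ (x^-1 * y) = t.
      by rewrite conjgM -{1}[t]invgK -(invT t x Tt Xx Bx) conjVg conjgK conjVg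
                 (invT t y Tt Xy By) invgK.
    by move: Tt; rewrite inE expg2 => /andP[_ tt] tV; rewrite {1}tV mulVg eqxx in tt.
  have X2 t : t \in X -> t ^+ 2 = 1.
    by move=> Xt; have := T0 t; rewrite inE Xt negbK => /eqP.
  exact: expg2_abelian.
have -> : X :=: B; last by [].
apply/eqP; rewrite eqEsubset sBX andbT -{1}XAX gen_subG.
apply/subsetP=> _ /imset2P[x a Xx Aa ->]; rewrite commgEl.
have Xxa : x ^ a \in X by rewrite memJ_norm ?(subsetP nXA).
have nBA : A \subset 'N(B).
  rewrite norms_gen //; apply/subsetP=> b Ab; rewrite inE.
  apply/subsetP=> _ /imsetP[t Tt ->]; move: Tt; rewrite !inE => /andP[Xt t2].
  by rewrite memJ_norm ?(subsetP nXA) // Xt -conjXg conjg_eq1.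
have [Bx | Bx] := boolP (x \in B).
  by rewrite groupM ?groupV // memJ_norm // (subsetP nBA).
by apply: BXX; rewrite // memJ_norm // (subsetP nBA).
Qed.

Definition has_Q8_section (gT : finGroupType) (P : {group gT}) : bool :=
  [exists A : {group gT}, exists B : {group gT},
     [&& A \subset P, B <| A & A / B \isog [set: 'Q_8]]].

Lemma quaternion_freeP (gT : finGroupType) (P : {group gT}) :
  reflect (quaternion_free P) (~~ has_Q8_section P).
Proof.
apply: (iffP idP) => [nQ A B sAP nBA | qf].
  apply: contra nQ => isoQ; apply/existsP; exists A; apply/existsP; exists B.
  by rewrite sAP nBA.
apply/existsP=> [[A /existsP[B /and3P[sAP nBA isoQ]]]].
by case/negP: (qf A B sAP nBA).
Qed.

Lemma has_Q8_sectionS (gT : finGroupType) (X P : {group gT}) :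
  X \subset P -> has_Q8_section X -> has_Q8_section P.
Proof.
move=> sXP /existsP[A /existsP[B /and3P[sAX nBA isoQ]]].
apply/existsP; exists A; apply/existsP; exists B.
by rewrite (subset_trans sAX sXP) nBA.
Qed.

Lemma has_Q8_section_morphim (gT rT : finGroupType) (P : {group gT})
    (f : {morphism P >-> rT}) :
  'injm f -> has_Q8_section (f @* P) -> has_Q8_section P.
Proof.
move=> injf /existsP[A /existsP[B /and3P[sAP nBA isoQ]]].
have preE (C : {group rT}) : C \subset f @* P ->
    exists2 C1 : {group gT}, C1 \subset P & C = (f @* C1)%G.
  move=> sCP; exists (f @*^-1 C)%G; first exact: subsetIl.
  by apply/val_inj; rewrite /= morphpreK.
have [A1 sA1 defA] := preE A sAP.
have [B1 sB1 defB] := preE B (subset_trans (normal_sub nBA) sAP).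
subst A B; have nB1 : B1 <| A1 by rewrite injm_normal in nBA.
apply/existsP; exists A1; apply/existsP; exists B1; rewrite sA1 nB1 /=.
apply: isog_trans isoQ.
pose g := [morphism of restrm sA1 f].
have gE (C : {group gT}) : C \subset A1 -> f @* C = g @* C.
  by move=> sCA; rewrite morphim_restrm (setIidPr sCA).
have -> : (f @* A1)%G = (g @* A1)%G by apply/val_inj/gE.
have -> : (f @* B1)%G = (g @* B1)%G by apply/val_inj/gE/normal_sub.
rewrite /= -(morphim_quotm g nB1); apply: sub_isog => //.
by apply: injm_quotm; rewrite injm_restrm.
Qed.

(** For [x] in a p-group [P], this says that [<[x]>] is one of the cyclic subgroups in the second
    alternative of the theorem. *)
Definition small_elt (gT : finGroupType) (P : {group gT}) (x : gT) : bool :=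
  prime #[x] || (#[x] == 4) && has_Q8_section P.

Lemma small_eltS (gT : finGroupType) (X P : {group gT}) x :
  X \subset P -> small_elt X x -> small_elt P x.
Proof.
move=> sXP /orP[px | /andP[x4 /(has_Q8_sectionS sXP) Q]].
  by rewrite /small_elt px.
by rewrite /small_elt x4 Q orbT.
Qed.

Lemma small_eltJ (gT : finGroupType) (P : {group gT}) x y :
  small_elt P (x ^ y) = small_elt P x.
Proof. by rewrite /small_elt orderJ. Qed.

Lemma Q8_section_of_action (gT : finGroupType) (A X : {group gT}) :
  2.-group X -> A \subset 'N(X) -> [~: X, A] = X ->
  A \subset 'C('Phi(X)) -> 'Phi(X) \subset 'Z(X) -> ~~ abelian X ->
  {in X, forall x, x ^+ 4 = 1} -> has_Q8_section X.
Proof.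
move=> pX nXA XAX cPhiA sPhiZ nabX X4.
have cPhiX : 'Phi(X) \subset 'C(X) by apply: subset_trans sPhiZ (subsetIr _ _).
have abPhi : abelian 'Phi(X) by apply: subset_trans cPhiX (centS (Phi_sub X)).
have eX : {in X &, forall x y, [~ x, y] ^+ 2 = 1}.
  move=> x y Xx Xy; rewrite -commXg.
    apply/eqP/commgP/(centsP cPhiX) => //; exact: Phi_pX.
  apply/commute_sym/(centsP cPhiX) => //.
  by rewrite (subsetP (Phi_der1 pX)) // mem_commg.
have e2Phi : 2.-abelem 'Phi(X).
  apply/abelemP=> //; split=> //.
  have gK : group_set [set u in 'Z(X) | u ^+ 2 == 1].
    apply/group_setP; split=> [|u v]; first by rewrite inE group1 expg1n eqxx.
    case/setIdP=> Zu /eqP u2 /setIdP[Zv /eqP v2]; apply/setIdP.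
    rewrite groupM // expgMn ?u2 ?v2 ?mulg1 //.
    exact: (centsP (center_abelian X)).
  suff /subsetP sPK : 'Phi(X) \subset Group gK.
    by move=> u /sPK /setIdP[_ /eqP].
  have := Phi_joing pX; rewrite (MhoE 1 pX) => ->.
  rewrite join_subG !gen_subG.
  apply/andP; split; apply/subsetP=> u.
    case/imset2P=> x y Xx Xy ->; apply/setIdP; rewrite eX //.
    by rewrite (subsetP sPhiZ) // (subsetP (Phi_der1 pX)) // mem_commg.
  case/imsetP=> x Xx ->; apply/setIdP; rewrite expn1.
  by rewrite (subsetP sPhiZ) ?(Phi_pX pX) // -expgM X4 ?eqxx.
have [c Xc nc1] : exists2 c, c \in X^`(1) & c != 1.
  by apply/trivgPn; apply: contra nabX => /eqP/derG1P.
have Pc : c \in 'Phi(X) by apply: (subsetP (Phi_der1 pX)).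
have scP : <[c]> \subset 'Phi(X) by rewrite cycle_subG.
have /splitsP[Y /complP[tiY defPhi]] : [splits 'Phi(X), over <[c]>].
  exact: abelem_splits e2Phi scP.
have sYP : Y \subset 'Phi(X) by rewrite -defPhi mulG_subr.
have sYX : Y \subset X := subset_trans sYP (Phi_sub X).
have nYX : X \subset 'N(Y).
  (* [Y] is normalized by [X] and by [A] because both centralize ['Phi(X)]. *)
  by rewrite cents_norm // centsC (subset_trans sYP).
have nYA : A \subset 'N(Y).
  by rewrite cents_norm // (subset_trans cPhiA) // centS.
have nYX' : Y <| X by apply/andP.
have ocP : #[c] = 2.
  by apply: nt_prime_order => //; case/abelemP: e2Phi => // _; apply.
have oPhi : #|'Phi(X)| = (2 * #|Y|)%N.
  by rewrite -defPhi TI_cardMg // -ocP.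
have cY : c \notin Y.
  apply: contra nc1 => Yc; have : c \in <[c]> :&: Y by rewrite inE cycle_id.
  by rewrite tiY inE.
have [|||||D sDX isoQ] := @Q8_subgroup _ (A / Y)%G (X / Y)%G.
- exact: quotient_pgroup.
- exact: quotient_norms.
- by rewrite /= -quotientR // XAX.
- apply: contra cY => abXY.
  have : X^`(1) \subset Y.
    by rewrite -quotient_cents2.
  by move/subsetP; apply.
- rewrite /= -(quotient_Phi pX) // card_quotient; last first.
    by rewrite (subset_trans (Phi_sub X)).
  by rewrite -divgS //= oPhi mulnK.
have [D1 defD sYD sDX1] := inv_quotientS nYX' sDX.
apply/existsP; exists D1; apply/existsP; exists Y.
by rewrite sDX1 -defD isoQ /normal sYD (subset_trans sDX1).
Qed.

(** [X] has class at most 2, with commutators of order dividing p and p-th powers fixed by [A]. So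
    [expg_hom_trivial] bounds the exponent by p, or by 4 when p = 2 and [X] is nonabelian, and in
    the latter case there is a ['Q_8] section. *)
Lemma small_elt_of_action (gT : finGroupType) p (A X : {group gT}) :
  prime p -> p.-group X -> A \subset 'N(X) -> [~: X, A] = X ->
  A \subset 'C('Phi(X)) -> {in X, forall x, x != 1 -> small_elt X x}.
Proof.
move=> p_pr pX nXA XAX cPhiA.
have cPhiX : 'Phi(X) \subset 'C(X).
  have : [~: A, X, 'Phi(X)] = 1.
    apply: three_subgroup.
      have sR : [~: X, 'Phi(X)] \subset 'Phi(X) by rewrite commg_subr gFnorm.
      by apply/commG1P; apply: subset_trans sR _; rewrite centsC.
    have -> : [~: 'Phi(X), A] = 1 by apply/commG1P; rewrite centsC.
    exact: comm1G.
  by rewrite (commGC A) XAX => /commG1P; rewrite centsC.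
have cPhi u v : u \in 'Phi(X) -> v \in X -> commute u v.
  by move=> Pu Xv; apply: (centsP cPhiX).
have PR u v : u \in X -> v \in X -> [~ u, v] \in 'Phi(X).
  by move=> Xu Xv; rewrite (subsetP (Phi_der1 pX)) // mem_commg.
have Rp u v : u \in X -> v \in X -> [~ u, v] ^+ p = 1.
  move=> Xu Xv; rewrite -commXg; last by apply/commute_sym/cPhi; rewrite ?PR.
  by apply/eqP/commgP/cPhi; rewrite ?(Phi_pX pX).
(* In class 2, [(x * y) ^+ n] differs from [x ^+ n * y ^+ n] by a commutator to the power
   ['C(n, 2)]. *)
have MX n : p %| 'C(n, 2) -> {in X &, forall x y, (x * y) ^+ n = x ^+ n * y ^+ n}.
  case/dvdnP=> k Ck x y Xx Xy; rewrite expMg_Rmul ?Ck; first last.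
  - by apply/commute_sym/cPhi; rewrite ?PR.
  - by apply/commute_sym/cPhi; rewrite ?PR.
  by rewrite mulnC expgM Rp // expg1n mulg1.
have cXn n : p %| n -> {in X, forall x, A \subset 'C[x ^+ n]}.
  case/dvdnP=> k -> x Xx; rewrite mulnC expgM sub_cent1 groupX //.
  by rewrite -sub1set centsC (subset_trans cPhiA) // centS // sub1set (Phi_pX pX).
have [abX | nabX] := boolP (abelian X).
  suff Xp : {in X, forall x, x ^+ p = 1}.
    by move=> x Xx x1; rewrite /small_elt (@nt_prime_order _ p) ?p_pr // Xp.
  apply: (expg_hom_trivial nXA XAX); last exact: cXn.
  by move=> x y Xx Xy; apply/expgMn/(centsP abX).
have [odd_p | p2] := boolP (odd p).
  suff Xp : {in X, forall x, x ^+ p = 1}.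
    by move=> x Xx x1; rewrite /small_elt (@nt_prime_order _ p) ?p_pr // Xp.
  apply: (expg_hom_trivial nXA XAX); last exact: cXn.
  by apply: MX; apply: prime_dvd_bin; rewrite //= odd_prime_gt2.
have {p2} p2 : p = 2 by case: (even_prime p_pr) p2 => // ->.
(* The exponent 4 is used because ['C(4, 2) = 6] is even, whereas ['C(2, 2) = 1] is not. *)
have X4 : {in X, forall x, x ^+ 4 = 1}.
  apply: (expg_hom_trivial nXA XAX); last by apply: cXn; rewrite p2.
  by apply: MX; rewrite p2.
have Q8 : has_Q8_section X.
  have sPhiZ : 'Phi(X) \subset 'Z(X) by rewrite subsetI Phi_sub.
  by rewrite p2 in pX; apply: (Q8_section_of_action pX nXA XAX).
move=> x Xx x1; have := X4 x Xx; rewrite /small_elt Q8 andbT.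
have [x2 _ | x2 x4] := eqVneq (x ^+ 2) 1; first by rewrite (nt_prime_order _ x2).
have : #[x] %| 2 ^ 2 by rewrite order_dvdn x4.
case/(dvdn_pfactor _ _ (isT : prime 2)) => [[|[|[|m]]]] // _ ox.
- by rewrite -order_eq1 ox in x1.
- by have := expg_order x; rewrite ox => /eqP; rewrite (negPf x2).
- by rewrite ox orbT.
Qed.

(** A minimal [A]-invariant subgroup [Y] of [X] not centralized by [A] satisfies [[~: Y, A] = Y],
    and [A] centralizes ['Phi(Y)]. Then all its nontrivial elements are small, hence fixed by
    [A]. *)
Lemma p'_centralizes_of_small (gT : finGroupType) p (A X : {group gT}) :
  prime p -> p.-group X -> p^'.-group A -> A \subset 'N(X) ->
  {in X, forall x, small_elt X x -> A \subset 'C[x]} -> A \subset 'C(X).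
Proof.
move=> p_pr pX p'A nXA cXA; apply: contraT => ncXA.
have [Y minY sYX] := @mingroup_exists _
  (fun Y : {group gT} => (A \subset 'N(Y)) && ~~ (A \subset 'C(Y))) X
  (introT andP (conj nXA ncXA)).
have {minY} [/andP[nYA ncYA] minY] := mingroupP minY.
have pY : p.-group Y := pgroupS sYX pX.
have coYA : coprime #|Y| #|A| by apply: pnat_coprime pY p'A.
have cA (Z : {group gT}) : A \subset 'N(Z) -> Z \proper Y -> A \subset 'C(Z).
  move=> nZA; rewrite properE => /andP[sZY]; apply: contraR => ncZA.
  by rewrite (minY Z) ?nZA.
have YAY : [~: Y, A] = Y.
  apply/eqP; apply: contraR ncYA => nYAY.
  apply: (coprime_comm_centralized nYA coYA (pgroup_sol pY)).
  apply: (cA [~: Y, A]%G); first by rewrite commg_normr.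
  by rewrite properEneq nYAY commg_subl.
have ntY : Y :!=: 1.
  by apply: contraNneq ncYA => ->; rewrite cents1.
have cPhi : A \subset 'C('Phi(Y)).
  by apply: (cA 'Phi(Y)%G); rewrite ?Phi_proper // gFnorm_trans.
have sY := small_elt_of_action p_pr pY nYA YAY cPhi.
case/negP: ncYA; rewrite centsC; apply/subsetP=> y Yy.
have [-> | y1] := eqVneq y 1; first exact: group1.
by rewrite -sub_cent1 cXA ?(subsetP sYX) // (small_eltS sYX) // sY.
Qed.

(** * Fusion and transfer *)

(** When [S] controls its own fusion, the transfer to [S / S^](1)[sends]x[in]S[to the class of]x ^+
    #|G : S|[. It kills]G^[(1)], and [#|G : S|] is coprime to [#|S|]. *)
Lemma fusion_der1 (gT : finGroupType) (p : nat) (G S : {group gT}) :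
  p.-Sylow(G) S ->
  {in S & G, forall x g, x ^ g \in S -> x ^ g \in x ^: S} ->
  S :&: G^`(1) \subset S^`(1).
Proof.
move=> sylS fusS; have [sSG pS p'S] := and3P sylS.
pose alpha := [morphism of restrm (der_norm 1 S) (coset S^`(1))].
have abA : abelian (alpha @* S).
  by rewrite morphim_restrm setIid; apply: sub_der1_abelian.
pose V := transfer_morphism G abA.
pose F0 x := FiniteModule.fmod abA (alpha x).
have F0M : {in S &, {morph F0 : x y / x * y}}.
  by move=> x y Sx Sy; rewrite /F0 morphM // FiniteModule.fmodM ?mem_morphim.
pose F := Morphism F0M.
have zcomm (u v : FiniteModule.fmod_of abA) : commute u v.
  by rewrite /commute !finalg.FinRing.zmodMgE ssralg.GRing.addrC.
have sG'V : G^`(1) \subset 'ker V.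
  rewrite gen_subG; apply/subsetP=> _ /imset2P[a b Ga Gb ->].
  apply/kerP; first by rewrite groupR.
  by rewrite morphR //; apply/eqP/commgP/zcomm.
have FJ : {in S &, forall x s, F (x ^ s) = F x}.
  move=> x s Sx Ss; rewrite morphJ // conjgE.
  by rewrite zcomm mulgK.
apply/subsetP=> x /setIP[Sx G'x]; have Gx := subsetP sSG x Sx.
have Vx : V x = 1 by apply/kerP; rewrite ?(subsetP sG'V).
have trX := transversalP (rcosets_cycle_partition sSG Gx).
(* Each factor of the transfer is a [G]-conjugate in [S] of a power of [x], hence an [S]-conjugate,
   with the same image in the abelian quotient. *)
have Fx : F (x ^+ #|G : S|) = 1.
  rewrite -(sum_index_rcosets_cycle sSG Gx trX) -Vx /V /=.
  rewrite (transfer_cycle_expansion sSG abA Gx trX).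
  apply: (big_rec2 (fun n v => F (x ^+ n) = v)) => [|y n v Xy <-].
    exact: morph1.
  rewrite expgD morphM ?groupX // finalg.FinRing.zmodMgE; congr (_ + _)%R.
  have Gy : y \in G by apply: subsetP Xy; apply: transversal_sub trX.
  have Sxy : (x ^+ #|<[x]> : S :* y|) ^ y^-1 \in S.
    have := mulg_exp_card_rcosets S x y.
    by rewrite mem_rcoset conjgE invgK mulgA.
  have /imsetP[s Ss defxy] := fusS _ _ (groupX _ Sx) (groupVr Gy) Sxy.
  by rewrite [in RHS]defxy; symmetry; apply: FJ; rewrite ?groupX.
have kx : x ^+ #|G : S| \in S^`(1).
  have Sxm : x ^+ #|G : S| \in S by rewrite groupX.
  have Am : alpha (x ^+ #|G : S|) \in alpha @* S by rewrite mem_morphim.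
  have : alpha (x ^+ #|G : S|) = 1.
    rewrite -(FiniteModule.fmodK abA Am) -(FiniteModule.fmval0 abA).
    by congr FiniteModule.fmval.
  by move/coset_idr; apply; rewrite (subsetP (der_norm 1 S)).
have coS : coprime #|S| #|G : S| by apply: pnat_coprime pS p'S.
by rewrite -(expgK coS Sx) groupX.
Qed.

Lemma pgroup_p'elt (gT : finGroupType) (p : nat) (G : {group gT}) :
  {in G, forall x, p^'.-elt x -> x = 1} -> p.-group G.
Proof.
move=> G1; apply/pgroupP=> q q_pr qG; have [x Gx ox] := Cauchy q_pr qG.
apply: contraT => pq; have p'x : p^'.-elt x by rewrite /p_elt ox pnatE.
by move: q_pr; rewrite -ox (G1 x Gx p'x) order1.
Qed.

Lemma quotient_pgroup_p'elt (gT : finGroupType) (p : nat) (N C : {group gT}) :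
  {in N, forall x, p^'.-elt x -> x \in C} -> N \subset 'N(C) -> p.-group (N / C).
Proof.
move=> NC nCN; apply: pgroup_p'elt => _ /morphimP[x Nx' Nx ->] p'x.
rewrite -[RHS](coset_id (NC _ (groupX _ Nx) (p_elt_constt p^' x))).
by rewrite -{1}(constt_p_elt p'x) morph_constt.
Qed.

(** * Frobenius' criterion: p'-subgroups that normalize p-subgroups centralize them *)

Section FrobeniusFusion.

Variables (gT : finGroupType) (p : nat) (G : {group gT}).
Hypothesis p'C : forall X A : {group gT}, X \subset G -> p.-group X ->
  A \subset 'N_G(X) -> p^'.-group A -> A \subset 'C(X).

Lemma p'elt_norm_cent (X : {group gT}) : X \subset G -> p.-group X ->
  {in 'N_G(X), forall x, p^'.-elt x -> x \in 'C_G(X)}.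
Proof.
move=> sXG pX x /setIP[Gx Nx] p'x; rewrite inE Gx -cycle_subG p'C //.
by rewrite cycle_subG inE Gx.
Qed.

(** Induction on the index of [D = P :&: Q]. Normalizers grow in p-groups, so Sylow subgroups of
    ['N_G(D)] containing ['N_P(D)] and ['N_Q(D)] link [P] to [Q] through Sylow subgroups of [G] with
    intersections larger than [D]. *)
Lemma Sylow_conj_centI (P Q : {group gT}) :
  p.-Sylow(G) P -> p.-Sylow(G) Q ->
  exists2 c, c \in 'C_G(P :&: Q) & Q :=: P :^ c.
Proof.
have [n] := ubnP (#|G| - #|P :&: Q|); elim: n => // n IHn in P Q *.
move=> /ltnSE-le_n sylP sylQ; have [sPG pP _] := and3P sylP.
have [sQG pQ _] := and3P sylQ.
have [PQ | neqPQ] := eqVneq (P : {set gT}) Q.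
  by exists 1; rewrite ?group1 ?conjsg1.
pose D := (P :&: Q)%G.
have sDP : D \subset P := subsetIl _ _; have sDQ : D \subset Q := subsetIr _ _.
have sDG : D \subset G := subset_trans sDP sPG.
have pD : p.-group D := pgroupS sDP pP.
have prDP : D \proper P.
  rewrite properE sDP subsetI subxx /=; apply: contra neqPQ => sPQ.
  by rewrite (sub_pHall sylP pQ sPQ sQG).
have prDQ : D \proper Q.
  rewrite properE sDQ subsetI subxx andbT /=; apply: contra neqPQ => sQP.
  by rewrite (sub_pHall sylQ pP sQP sPG).
have ltNP := nilpotent_proper_norm (pgroup_nil pP) prDP.
have ltNQ := nilpotent_proper_norm (pgroup_nil pQ) prDQ.
have IH (U V : {group gT}) : p.-Sylow(G) U -> p.-Sylow(G) V -> D \proper U :&: V ->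
    exists2 c, c \in 'C_G(D) & V :=: U :^ c.
  move=> sylU sylV ltD; case: (IHn U V) => // [|c].
    apply: leq_trans le_n; rewrite ltn_sub2l //.
      apply: leq_trans (proper_card ltD) _.
      by rewrite subset_leq_card // subIset ?(pHall_sub sylU).
    exact: proper_card.
  case/setIP=> Gc cc ->; exists c => //; rewrite inE Gc.
  by rewrite (subsetP (centS (proper_sub ltD))).
have [S sylS sNS] := Sylow_superset (setSI 'N(D) sPG) (pgroupS (subsetIl _ _) pP).
have [T sylT sNT] := Sylow_superset (setSI 'N(D) sQG) (pgroupS (subsetIl _ _) pQ).
have [sSN pS _] := and3P sylS; have [sTN pT _] := and3P sylT.
(* ['N_G(D) / 'C_G(D)] is a p-group, so ['N_G(D) = S * 'C_G(D)] and the conjugating element can be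
   taken in ['C_G(D)]. *)
have [c Cc defT] : exists2 c, c \in 'C_G(D) & T :=: S :^ c.
  have [m Nm ->] := Sylow_trans sylS sylT.
  have nCN : 'N_G(D) \subset 'N('C_G(D)).
    by rewrite normsI ?norms_cent ?subsetIr // subIset // normG.
  have pN : p.-group ('N_G(D) / 'C_G(D)).
    exact: quotient_pgroup_p'elt (p'elt_norm_cent sDG pD) nCN.
  have defN : S * 'C_G(D) = 'N_G(D).
    apply: coprime_index_mulG => //; first by rewrite setIS ?cent_sub.
    rewrite coprime_sym -card_quotient //.
    by apply: pnat_coprime pN _; case/and3P: sylS.
  have /mulsgP[s c Ss Cc ->] : m \in S * 'C_G(D) by rewrite defN.
  by exists c => //; rewrite conjsgM conjGid.
have [R sylR sSR] := Sylow_superset (subset_trans sSN (subsetIl _ _)) pS.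
have [c1 Cc1 defR] : exists2 c1, c1 \in 'C_G(D) & R :=: P :^ c1.
  apply: IH => //; apply: proper_sub_trans ltNP _.
  by rewrite subsetI subsetIl (subset_trans sNS).
have Gc : c \in G by case/setIP: Cc.
have sylRc : p.-Sylow(G) (R :^ c)%G by rewrite pHallJ.
have [c2 Cc2 defQ] : exists2 c2, c2 \in 'C_G(D) & Q :=: (R :^ c)%G :^ c2.
  apply: IH => //; apply: proper_sub_trans ltNQ _.
  by rewrite subsetI subsetIl andbT (subset_trans sNT) //= defT conjSg.
exists (c1 * c * c2); first by rewrite !groupM.
by rewrite !conjsgM -defR.
Qed.

Lemma perfect_Sylow_trivial (P : {group gT}) :
  p.-Sylow(G) P -> G^`(1) = G -> P :=: 1.
Proof.
move=> sylP G'; have [sPG pP _] := and3P sylP; apply: contraTeq (subxx P) => ntP.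
have fusP : {in P & G, forall x g, x ^ g \in P -> x ^ g \in x ^: P}.
  move=> x g Px Gg Pxg.
  have sylPg : p.-Sylow(G) (P :^ g)%G by rewrite pHallJ.
  have [c /setIP[Gc /centP cc] defP] := Sylow_conj_centI sylPg sylP.
  have Ngc : g * c \in 'N_G(P).
    by rewrite inE groupM //=; apply/normP; rewrite conjsgM -defP.
  have -> : x ^ g = x ^ (g * c).
    rewrite conjgM [RHS]conjgE -cc ?mulKg //.
    by rewrite inE Pxg memJ_conjg Px.
  rewrite -(consttC p (g * c)) conjgM.
  have Pm : (g * c).`_p \in P.
    rewrite (mem_normal_Hall (_ : p.-Sylow('N_G(P)) P)) ?Sylow_subnorm ?normalSG //.
      exact: p_elt_constt.
    exact: groupX.
  have /setIP[_ /centP cm] := p'elt_norm_cent sPG pP (groupX _ Ngc)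
    (p_elt_constt p^' (g * c)).
  by rewrite [_ ^ (g * c).`_p^']conjgE -cm ?groupJ // mulKg memJ_class.
have sPP' := fusion_der1 sylP fusP.
rewrite G' (setIidPl sPG) in sPP'.
have := sol_der1_proper (pgroup_sol pP) (subxx P) ntP.
by rewrite properE sPP' andbF.
Qed.

End FrobeniusFusion.

(** * Sylow subgroups with p-nilpotent normalizer *)

Section NormalizerCondition.

Variables (gT : finGroupType) (p : nat) (E P : {group gT}).
Hypothesis sylP : p.-Sylow(E) P.
Hypothesis nPcP : 'N_E(P) \subset P * 'C(P).

Let sPE : P \subset E := pHall_sub sylP.
Let pP : p.-group P := pHall_pgroup sylP.

(** [V] meets the center of [P], so [P] lies in the normal subgroup ['C_E(V)]. By Frattini
    [E = 'C_E(V) * 'N_E(P)], and ['N_E(P)] centralizes [V] too. *)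
Lemma prime_normal_central (V : {group gT}) :
  prime p -> V <| E -> #|V| = p -> E \subset 'C(V).
Proof.
move=> p_pr nVE oV; have pV : p.-group V by rewrite /pgroup oV pnat_id.
have sVP : V \subset P.
  by rewrite (subset_trans _ (pcore_sub_Hall sylP)) // pcore_max.
have cVP : P \subset 'C(V).
  have nVP : V <| P := normalS sVP sPE nVE.
  have ntV : V :!=: 1 by rewrite -cardG_gt1 oV prime_gt1.
  have := meet_center_nil (pgroup_nil pP) nVP ntV.
  rewrite centsC => /(prime_meetG (eq_ind_r prime p_pr oV)) sVZ.
  exact: subset_trans sVZ (subsetIr _ _).
have nCE : 'C_E(V) <| E.
  by rewrite /normal subsetIl normsI ?normG // norms_cent // normal_norm.
have sylPC : p.-Sylow('C_E(V)) P.
  by apply: pHall_subl sylP; rewrite ?subsetIl // subsetI sPE.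
rewrite -(Frattini_arg nCE sylPC) mul_subG ?subsetIr //.
apply: subset_trans nPcP _.
by rewrite mul_subG // centS.
Qed.

(** The preimage of ['N_(E / U)(P / U)] normalizes [P <*> U]; by Frattini it is [P <*> U] times its
    intersection with ['N(P)]. *)
Lemma quotient_norm_Sylow (U : {group gT}) :
  U <| E -> 'N_(E / U)(P / U) \subset (P / U) * 'C(P / U).
Proof.
move=> nUE; have [sUE nUEn] := andP nUE.
have nUP := subset_trans sPE nUEn.
have nUPE : P <*> U \subset E by rewrite join_subG sPE.
pose L := 'N_E(P <*> U)%G.
have nPUL : P <*> U <| L.
  by rewrite /normal subsetI nUPE normG subsetIr.
have sylPU : p.-Sylow(P <*> U) P by apply: pHall_subl sylP; rewrite ?joing_subl.
have defNU : 'N_(E / U)(P / U) = L / U.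
  rewrite -(quotientYidr nUP) -quotient_subnormG //.
  by rewrite /normal joing_subr join_subG nUP normG.
have sNE : 'N_L(P) \subset P * 'C_E(P).
  rewrite [_ :&: 'C(P)]setIC group_modl // subsetI.
  rewrite (subset_trans (subsetIl _ _) (subsetIl _ _)) andbT.
  by apply: subset_trans nPcP; rewrite setSI ?subsetIl.
have sLU : L / U \subset (P / U) * ('N_L(P) / U).
  rewrite -{1}(Frattini_arg nPUL sylPU) quotientMl; last first.
    by rewrite join_subG nUP normG.
  by rewrite quotientYidr.
have sNU : 'N_L(P) / U \subset (P / U) * 'C(P / U).
  apply: subset_trans (quotientS U sNE) _; rewrite quotientMl // mulgS //.
  exact: subset_trans (quotientS _ (subsetIr _ _)) (quotient_cent _ _).
rewrite defNU; apply: subset_trans sLU _.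
by apply: subset_trans (mulgS _ sNU) _; rewrite mulgA mulGid.
Qed.

End NormalizerCondition.

Lemma prime_section_central (gT : finGroupType) (p : nat) (E P U V : {group gT}) :
  p.-Sylow(E) P -> 'N_E(P) \subset P * 'C(P) -> prime p ->
  U <| E -> V <| E -> U \subset V -> #|V : U| = p -> [~: V, E] \subset U.
Proof.
move=> sylP nPcP p_pr nUE nVE sUV iVU.
have nUEn := normal_norm nUE; have nUV := subset_trans (normal_sub nVE) nUEn.
rewrite -quotient_cents2 // centsC.
have sylPU : p.-Sylow(E / U) (P / U).
  by rewrite quotient_pHall // (subset_trans (pHall_sub sylP)).
apply: (prime_normal_central sylPU (quotient_norm_Sylow sylP nPcP nUE)) => //.
  exact: quotient_normal.
by rewrite card_quotient.
Qed.

(* S is central in its normalizer, so it controls its fusion and W' is a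
   p'-group. *)
Lemma prime_Sylow_pgroup (gT : finGroupType) (p : nat) (E P W : {group gT}) :
  p.-Sylow(E) P -> 'N_E(P) \subset P * 'C(P) -> prime p ->
  W <| E -> 'O_p^'(W) = 1 -> #|P :&: W| = p -> p.-group W.
Proof.
move=> sylP nPcP p_pr nWE W1 oS; pose S := (P :&: W)%G.
have [sPE pP _] := and3P sylP; have [sWE nEW] := andP nWE.
have sylS : p.-Sylow(W) S := Hall_setI_normal nWE sylP.
have sSP : S \subset P := subsetIl _ _.
have nSP : P \subset 'N(S) by rewrite normsI ?normG // (subset_trans sPE).
have sylPN : p.-Sylow('N_E(S)) P.
  by apply: pHall_subl sylP; rewrite ?subsetIl // subsetI sPE.
have cNS : 'N_E(S) \subset 'C(S).
  apply: (prime_normal_central sylPN) => //; last first.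
    by rewrite /normal subsetIr subsetI (subset_trans sSP) ?normG.
  by apply: subset_trans nPcP; rewrite setSI ?subsetIl.
have fusS : {in S & W, forall x g, x ^ g \in S -> x ^ g \in x ^: S}.
  move=> x g Sx Wg Sxg; suff -> : x ^ g = x by apply: class_refl.
  have [-> | x1] := eqVneq x 1; first by rewrite conj1g.
  (* As [S] has order p, nontrivial [x] and [x ^ g] both generate it, so [g] normalizes and then
     centralizes [S]. *)
  have genS y : y \in S -> y != 1 -> S \subset <[y]>.
    move=> Sy y1.
    apply: prime_meetG; first by rewrite oS.
    by rewrite (setIidPr _) ?cycle_subG // cycle_eq1.
  have NSg : g \in 'N_E(S).
    rewrite inE (subsetP sWE) //=; apply/normP/eqP.
    rewrite eqEcard cardJg leqnn andbT.
    have sSx : S :^ g \subset <[x]> :^ g by rewrite conjSg genS.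
    by apply: subset_trans sSx _; rewrite -cycleJ cycle_subG.
  by rewrite conjgE -(centP (subsetP cNS g NSg)) // mulKg.
have abS : abelian S.
  by apply: subset_trans cNS; rewrite subsetI (subset_trans sSP) ?normG.
have SW' : S :&: W^`(1) = 1.
  by apply/trivgP; rewrite -(derG1P abS); apply: fusion_der1 sylS fusS.
have W'1 : W^`(1) = 1.
  apply/trivgP; rewrite -W1 pcore_max ?der_normal //.
  have := Hall_setI_normal (der_normal 1 W) sylS; rewrite SW' => /card_Hall/esym/eqP.
  by rewrite cards1 partG_eq1.
have nilW : nilpotent W by apply/abelian_nil/derG1P.
have := nilpotent_pcoreC p nilW; rewrite W1 dprodg1 => <-; exact: pcore_pgroup.
Qed.

(** * Chains replacing chief series *)

(** With [S] a Sylow subgroup containing [K], [G = S * 'N_G(K)]; hence every Sylow subgroup is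
    [S :^ n] with [n] normalizing [K], and contains [K]. *)
Lemma sub_pcore_norm_index (gT : finGroupType) (p : nat) (G K : {group gT}) :
  K \subset G -> p.-group K -> p.-nat #|G : 'N_G(K)| -> K \subset 'O_p(G).
Proof.
move=> sKG pK pNK; have [S sylS sKS] := Sylow_superset sKG pK.
have [sSG pS p'S] := and3P sylS.
have defG : S * 'N_G(K) = G.
  apply: coprime_index_mulG; rewrite ?subsetIl // coprime_sym.
  exact: pnat_coprime pNK p'S.
apply/bigcapsP=> T; rewrite max_pgroup_Sylow => sylT.
have [g Gg ->] := Sylow_trans sylS sylT.
have /mulsgP[s n Ss /setIP[_ /normP Kn] ->] : g \in S * 'N_G(K) by rewrite defG.
by rewrite conjsgM (conjGid Ss) -Kn conjSg.
Qed.

(** What a chief factor [V / U] says about a p-subgroup [H]; [(H :&: V) * U] is the preimage of the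
    trace of [H]. The case [U = V] is allowed because factors may collapse in quotients. *)
Definition pi_step (gT : finGroupType) (p : nat) (G H U V : {group gT}) : Prop :=
  [/\ U <| G, V <| G, U \subset V,
      forall L : {group gT}, L <| G -> U \subset L -> L \subset V ->
        L :=: U \/ L :=: V
    & (H :&: V \subset U \/ p.-nat #|V : U|)
      /\ p.-nat #|G : 'N_G((H :&: V) * U)|].

(* Q ranges over arbitrary properties, so this amounts to the existence of a
   chain of steps from 1 to G; unlike a chief series, it passes to quotients
   without removing repetitions. *)
Definition pi_chain (gT : finGroupType) (p : nat) (G H : {group gT}) : Prop :=
  forall Q : pred {group gT}, ~~ Q 1%G -> Q G ->
    exists U V : {group gT}, [/\ pi_step p G H U V, ~~ Q U & Q V].

(** The trace is a p-group, so the index is a power of p. A nontrivial trace lies in ['O_p(G / U)],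
    which then contains all of the chief factor [V / U]. *)
Lemma chief_pi_step (gT : finGroupType) (p : nat) (G H U V : {group gT}) :
  prime p -> p.-group H -> H \subset G -> U <| G -> chief_factor G U V ->
  let K := (H * U) / U :&: V / U in
  (\pi(K)).-nat #|G / U : 'N_(G / U)(K)| -> pi_step p G H U V.
Proof.
move=> p_pr pH sHG nUG /andP[maxU nVG] K.
have [/andP[prUV nUGn] maxUV] := maxgroupP maxU.
have sUV := proper_sub prUV; have sVG := normal_sub nVG.
have nUH := subset_trans sHG nUGn; have nUV := subset_trans sVG nUGn.
pose K1 := ((H :&: V) / U)%G.
have -> : K = K1 by rewrite /K quotientMidr -quotientIG.
move=> piK; have pK1 : p.-group K1.
  by rewrite quotient_pgroup // (pgroupS (subsetIl _ _)).
have pK : p.-nat #|G / U : 'N_(G / U)(K1)|.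
  apply: sub_in_pnat piK => q _; rewrite /= mem_primes => /and3P[q_pr _ qK].
  exact: (pgroupP pK1).
have defX : (H :&: V) * U = (H :&: V) <*> U.
  by rewrite norm_joinEl // subIset ?nUH.
have nUX : U <| (H :&: V) <*> U.
  by rewrite /normal joing_subr join_subG normG subIset ?nUH.
have defNK : 'N_(G / U)(K1) = 'N_G((H :&: V) * U) / U.
  rewrite defX quotient_subnormG // quotientYidr //.
  by rewrite subIset ?nUH.
have chUV (L : {group gT}) : L <| G -> U \subset L -> L \subset V -> L :=: U \/ L :=: V.
  move=> nLG sUL; rewrite subEproper => /predU1P[-> | prLV]; first by right.
  by left; apply: (maxUV L) => //; rewrite prLV normal_norm.
split=> //; split; last first.
  rewrite defNK index_quotient_eq ?subsetIl // in pK.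
  rewrite subsetI subsetIl /= subIset // defX.
  by rewrite (subset_trans (joing_subr (H :&: V) U)) ?normG ?orbT.
have [sHU | nsHU] := boolP (H :&: V \subset U); [by left | right].
have sK1G : K1 \subset G / U by rewrite quotientS // subIset ?sHG.
have sK1O := sub_pcore_norm_index sK1G pK1 pK.
have nOG : 'O_p(G / U) :&: (V / U) <| G / U.
  by rewrite normalI ?pcore_normal ?quotient_normal.
have [L defL sUL nLG] := inv_quotientN nUG nOG.
have sLV : L \subset V.
  by rewrite -(quotientSGK _ sUV) ?(subset_trans (normal_sub nLG)) // -defL subsetIr.
have [defLU | defLV] := chUV L nLG sUL sLV.
  have sK1L : (H :&: V) / U \subset L / U.
    by rewrite -defL subsetI sK1O quotientS ?subsetIr.
  rewrite defLU quotientSGK ?subxx // in sK1L; first by rewrite sK1L in nsHU.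
  by rewrite subIset ?nUH.
rewrite -card_quotient //= -defLV -defL.
by apply: pgroupS (subsetIl _ _) (pcore_pgroup _ _).
Qed.

Lemma partial_Pi_chain (gT : finGroupType) (p : nat) (G H : {group gT}) :
  prime p -> p.-group H -> H \subset G -> partial_Pi G H -> pi_chain p G H.
Proof.
move=> p_pr pH sHG [s [chs lastG piK]] Q Q1 QG.
have hasQ : has Q s.
  case: s {chs piK} lastG => [/= defG | x s1 lastG]; first by rewrite defG QG in Q1.
  by apply/hasP; exists G; rewrite // -lastG /= mem_last.
(* The first term of [s] satisfying [Q]; entry [i] of [1 :: s] is its predecessor, where [Q] still
   fails. *)
pose i := find Q s; have lti : i < size s by rewrite -has_find.
exists (nth 1%G (1%G :: s) i), (nth 1%G s i).
have chi : chief_factor G (nth 1%G (1%G :: s) i) (nth 1%G s i).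
  exact: (pathP 1%G chs).
split; last exact: nth_find.
- apply: chief_pi_step => //; last exact: piK.
  case: (i) lti => [|j] ltj /=; first exact: normal1.
  by have /andP[] := pathP 1%G chs j (ltnW ltj).
- case di: i => [|j] //=.
  by rewrite (@before_find _ 1%G Q s) // -/i di.
Qed.

(** The condition on [H :&: (W * N)] makes traces commute with passing to [G / N]; without it the
    image of [H] could meet [V / N] in more than the image of [H :&: V]. *)
Lemma pi_step_quotient (gT : finGroupType) (p : nat) (G H U V N : {group gT}) :
  N <| G -> H \subset G ->
  (forall W : {group gT}, W <| G -> H :&: (W * N) \subset (H :&: W) * N) ->
  pi_step p G H U V -> pi_step p (G / N) (H / N) (U / N) (V / N).
Proof.
move=> nNG sHG HN [nUG nVG sUV chUV [pUV pNH]].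
have nN (A : {group gT}) : A \subset G -> A \subset 'N(N).
  by move=> sAG; apply: subset_trans sAG (normal_norm nNG).
have nNH := nN _ sHG; have nNU := nN _ (normal_sub nUG).
have nNV := nN _ (normal_sub nVG).
have nNHV : H :&: V \subset 'N(N) by rewrite subIset ?nNH.
have defHV : H / N :&: V / N = (H :&: V) / N.
  apply/eqP; rewrite eqEsubset quotientI andbT.
  have -> : V / N = (V <*> N) / N by rewrite quotientYidr.
  rewrite -quotientIG ?joing_subr //= norm_joinEl //.
  by apply: subset_trans (quotientS N (HN V nVG)) _; rewrite quotientMidr.
split; rewrite ?quotient_normal ?quotientS //.
  move=> L nLG sUL sLV; have [K defK sNK nKG] := inv_quotientN nNG nLG.
  have nNK := nN _ (normal_sub nKG).
  have nUKV : U <*> (K :&: V) <| G by rewrite normalY // normalI.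
  have [||defU | defV] := chUV _ nUKV; rewrite ?joing_subl //.
  - by rewrite join_subG sUV subsetIr.
  - left; apply/eqP; rewrite eqEsubset sUL andbT.
    have sLKV : L \subset (K :&: V) / N by rewrite quotientGI // subsetI -defK subxx.
    by apply: subset_trans sLKV _; rewrite quotientS // -defU joing_subr.
  right; apply/eqP; rewrite eqEsubset sLV /= -defV quotientY //; last first.
    by rewrite subIset ?nNK.
  by rewrite join_subG sUL defK quotientS // subsetIl.
rewrite defHV; split; last first.
  rewrite -quotientMl //.
  apply: pnat_dvd pNH; set X := (H :&: V) * U.
  have sNX : 'N_G(X) / N \subset 'N_(G / N)(X / N) := quotient_subnorm _ _ _.
  apply: dvdn_trans (indexgS (G / N)%G sNX) _; apply: index_quotient.
  by rewrite subIset // nN.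
case: pUV => [sHU | pUV]; [left | right]; first exact: quotientS.
by apply: pnat_dvd pUV; rewrite index_quotient // subIset ?nNV.
Qed.

Lemma pi_chain_quotient (gT : finGroupType) (p : nat) (G H N : {group gT}) :
  N <| G -> H \subset G ->
  (forall W : {group gT}, W <| G -> H :&: (W * N) \subset (H :&: W) * N) ->
  pi_chain p G H -> pi_chain p (G / N) (H / N).
Proof.
move=> nNG sHG HN chH Q Q1 QG.
have [||U [V [stUV QU QV]]] := chH (fun U => Q (U / N)%G) => //.
  suff -> : (1 / N)%G = 1%G by [].
  by apply/val_inj; rewrite /= quotient1.
exists (U / N)%G, (V / N)%G; split=> //.
exact: pi_step_quotient.
Qed.

(** For [A = W :&: E], both [P :&: A] and [P :&: A <*> N] map onto a Sylow subgroup of [A / N]. So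
    an element of [H] in [W * N] is a product of an element of [P :&: N], which lies in [H], and one
    of [W]. *)
Lemma Sylow_setI_mul_sub (gT : finGroupType) (p : nat) (G E P H N W : {group gT}) :
  E <| G -> p.-Sylow(E) P -> N <| G -> N \subset E -> W <| G ->
  H \subset P -> P :&: N \subset H -> H :&: (W * N) \subset (H :&: W) * N.
Proof.
move=> nEG sylP nNG sNE nWG sHP sPNH; have sPE := pHall_sub sylP.
have nNE : N <| E by apply: normalS nNG => //; apply: normal_sub.
have nNP := subset_trans sPE (normal_norm nNE).
pose A := (W :&: E)%G.
have nAE : A <| E.
  rewrite /normal subsetIr normsI ?normG //.
  exact: subset_trans (normal_sub nEG) (normal_norm nWG).
have sAE := normal_sub nAE; have nNA := subset_trans sAE (normal_norm nNE).
have nANE : A <*> N <| E by rewrite normalY.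
have sylA : p.-Sylow(A / N) ((P :&: A) / N).
  apply: quotient_pHall; first by rewrite subIset ?nNP.
  exact: Hall_setI_normal nAE sylP.
have sylAN : p.-Sylow(A / N) ((P :&: A <*> N) / N).
  rewrite -(quotientYidr nNA); apply: quotient_pHall; first by rewrite subIset ?nNP.
  exact: Hall_setI_normal nANE sylP.
have sPAN : P :&: A <*> N \subset N * (P :&: A).
  rewrite -quotientSK ?subIset ?nNP //.
  by rewrite (sub_pHall sylA (pHall_pgroup sylAN)) ?(pHall_sub sylAN) //
             quotientS // setIS ?joing_subl.
apply/subsetP=> h /setIP[Hh /mulsgP[w n Ww Nn defh]].
have Ph := subsetP sHP h Hh.
have Aw : w \in A.
  have Eh := subsetP sPE h Ph; have En := subsetP sNE n Nn.
  by rewrite inE Ww -(mulgK n w) -defh groupM ?groupV.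
have : h \in N * (P :&: A).
  by apply: (subsetP sPAN); rewrite inE Ph norm_joinEl // defh mem_mulg.
case/mulsgP=> m a Nm /setIP[Pa /setIP[Wa _]] defh2.
have Hm : m \in H.
  by rewrite (subsetP sPNH) // inE Nm andbT -(mulgK a m) -defh2 groupM ?groupV.
have Ha : a \in H by rewrite -(mulKg m a) -defh2 groupM ?groupV.
have nNHW : H :&: W \subset 'N(N) by rewrite subIset // (subset_trans sHP).
by rewrite (normC nNHW) defh2 mem_mulg // inE Ha.
Qed.

(** * Maximal subgroups of the Sylow subgroup *)

Lemma dvdn_index_norm (gT : finGroupType) (G A B : {group gT}) :
  A \subset G -> B \subset G -> B \subset 'N(A) -> #|A : B| %| #|G : B|.
Proof.
move=> sAG sBG nAB; rewrite -indexMg -norm_joinEl ?indexSg ?joing_subl //.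
by rewrite join_subG sBG.
Qed.

(** The index in [E] of the normalizer of [D] is a power of p, and prime to p because [P] normalizes
    [D]. *)
Lemma norm_of_p_index (gT : finGroupType) (p : nat) (G E P : {group gT}) (D : {set gT}) :
  E <| G -> p.-Sylow(E) P -> P \subset 'N(D) -> p.-nat #|G : 'N_G(D)| ->
  E \subset 'N(D).
Proof.
move=> /andP[sEG nEG] sylP nDP pD; have [sPE _ p'P] := and3P sylP.
have : #|E : 'N_G(D)| == 1%N.
  apply/eqP/(@pnat_1 p).
    apply: pnat_dvd pD; rewrite dvdn_index_norm ?subsetIl //.
    exact: subset_trans (subsetIl _ _) nEG.
  apply: pnat_dvd p'P; apply: indexgS.
  by rewrite subsetI nDP (subset_trans sPE).
by rewrite indexg_eq1 subsetI => /andP[].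
Qed.

Lemma maximal_chain_normal (gT : finGroupType) (p : nat) (G E P M : {group gT}) :
  prime p -> E <| G -> p.-Sylow(E) P -> 'N_E(P) \subset P * 'C(P) ->
  'O_p^'(E) = 1 -> maximal M P -> pi_chain p G M ->
  exists W : {group gT},
    [/\ W :!=: 1, W <| G, W \subset E, p.-group W & [~: W, E] \subset M].
Proof.
move=> p_pr nEG sylP nPcP E1 maxM chM; have [sPE pP _] := and3P sylP.
have [sMP _] := andP (maxgroupp maxM).
have [sEG nEGn] := andP nEG.
have nMP := p_maximal_normal pP maxM; have iPM := p_maximal_index pP maxM.
have ltMP : M \proper P := maxgroupp maxM.
have ntP : P :!=: 1.
  by apply: contraTneq ltMP => ->; rewrite properE sub1G andbF.
have ntE : E :!=: 1.
  by apply: contraNneq ntP => E0; rewrite -subG1 -E0.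
(* The step is chosen with [E :&: U = 1], so that [W = E :&: V] embeds in [V / U]. *)
have [||U [V [stUV]]] := chM (fun U => E :&: U != 1).
- by rewrite setIg1 eqxx.
- by rewrite (setIidPl sEG).
have [nUG nVG sUV _ [pUV pNM]] := stUV.
move/negPn/eqP=> EU1 EV1; pose W := (E :&: V)%G.
have nWG : W <| G by apply: normalI.
have sWE : W \subset E := subsetIl _ _; have sWV : W \subset V := subsetIr _ _.
have nWE : W <| E := normalS sWE sEG nWG.
have W1 : 'O_p^'(W) = 1.
  apply/trivgP; rewrite -E1 pcore_max ?pcore_pgroup //.
  exact: gFnormal_trans.
have MVW : M :&: V = M :&: W.
  by rewrite setIA (setIidPl (subset_trans sMP sPE)).
have pW : p.-group W.
  case: pUV => [sMVU | pVU].
    (* Since [M] has index p in [P] and meets [W] trivially, [P :&: W] has order p. *)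
    have MW1 : M :&: W = 1.
      have : M :&: V \subset E :&: U by rewrite subsetI sMVU subIset // (subset_trans sMP).
      by rewrite EU1 MVW => /trivgP.
    have sylPW := Hall_setI_normal nWE sylP.
    apply: (prime_Sylow_pgroup sylP nPcP p_pr nWE W1).
    have ntPW : P :&: W != 1.
      apply: contraNneq EV1 => PW1; rewrite -subG1 -W1 pcore_pgroup_id ?subxx //.
      by move/card_Hall/esym/eqP: sylPW; rewrite /= PW1 cards1 partG_eq1.
    have [_ pPW _] := pgroup_pdiv (pgroupS (subsetIl P W) pP) ntPW.
    apply/eqP; rewrite eqn_leq [p <= _]dvdn_leq // andbT.
    rewrite -(leq_pmul2l (cardG_gt0 M)) -iPM Lagrange // -TI_cardMg.
      by rewrite subset_leq_card // mul_subG ?subsetIl.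
    by rewrite setIA (setIidPl sMP).
  rewrite /pgroup -indexg1 -[1]EU1.
  have -> : #|W : E :&: U| = #|W : U|.
    by rewrite -[RHS]indexgI; congr #|_ : _|; rewrite /= -setIA (setIidPr sUV).
  apply: pnat_dvd pVU; apply: dvdn_index_norm => //.
  exact: subset_trans (normal_sub nUG) (normal_norm nWG).
exists W; split=> //.
have sWP : W \subset P.
  by rewrite (subset_trans _ (pcore_sub_Hall sylP)) // pcore_max.
have [sWM | nsWM] := boolP (W \subset M).
  by apply: subset_trans sWM; rewrite commg_subl normal_norm.
have nMW := subset_trans sWP (normal_norm nMP).
pose D := (M :&: W)%G.
have defMW : M <*> W = P.
  have [_ maxP] := maxgroupP maxM; apply/eqP; rewrite eqEproper join_subG sMP sWP /=.
  apply: contra nsWM => ltMW.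
  by rewrite -[M : {set gT}](maxP (M <*> W)%G) ?joing_subl ?joing_subr.
have iWD : #|W : D| = p.
  rewrite -[RHS]iPM -defMW norm_joinEr // indexMg -[RHS]indexgI.
  by congr #|_ : _|; rewrite /= setIC.
have nDP : P \subset 'N(D).
  by rewrite normsI ?normal_norm // (normalS sWP sPE).
(* Intersecting [(M :&: V) * U] with [E] gives [D], as [E :&: U = 1]; hence the normalizer of [D]
   has p-power index in [G]. *)
have nDE : D <| E.
  rewrite /normal (subset_trans (subsetIr _ _) sWE).
  apply: (norm_of_p_index nEG sylP nDP).
  apply: pnat_dvd pNM; apply: indexgS.
  rewrite subsetI subsetIl /=; apply/subsetP=> g /setIP[Gg Ng].
  have -> : D = E :&: ((M :&: V) * U) :> {set gT}.
    rewrite [E :&: _]setIC -group_modl; last by rewrite subIset // (subset_trans sMP).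
    by rewrite [U :&: E]setIC EU1 mulg1 MVW.
  rewrite inE conjIg (normP Ng); apply: setSI.
  by rewrite (normP (subsetP nEGn g Gg)).
apply: subset_trans (_ : _ \subset D) (subsetIl _ _).
exact: prime_section_central sylP nPcP p_pr nDE nWE (subsetIr _ _) iWD.
Qed.

(** From here on, p-nilpotence of [E] is expressed by ['O_p^'(E)] being a Hall p'-subgroup. *)
Lemma p'core_Hall_pgroup (gT : finGroupType) (p : nat) (E : {group gT}) :
  'O_p^'(E) = 1 -> p^'.-Hall(E) 'O_p^'(E) -> p.-group E.
Proof. by move=> -> /and3P[_ _]; rewrite indexg1 pnatNK. Qed.

Lemma p'core_Hall_quotient (gT : finGroupType) (p : nat) (E : {group gT}) :
  p^'.-Hall(E / 'O_p^'(E)) 'O_p^'(E / 'O_p^'(E)) -> p^'.-Hall(E) 'O_p^'(E).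
Proof.
move/p'core_Hall_pgroup => /(_ (trivg_pcore_quotient _ _)) pEO.
rewrite /pHall pcore_sub pcore_pgroup pnatNK -card_quotient ?gFnorm //.
Qed.

(** The preimages of the two p'-cores meet in a normal subgroup [K], a p'-group because [K / N1] is
    one and [K :&: N1] embeds in [E / N2]. So [K] is trivial, yet it contains every p'-element of
    [E]. *)
Lemma pgroup_of_TI_quotients (gT : finGroupType) (p : nat) (E N1 N2 : {group gT}) :
  N1 <| E -> N2 <| E -> N1 :&: N2 = 1 -> 'O_p^'(E) = 1 ->
  p^'.-Hall(E / N1) 'O_p^'(E / N1) -> p^'.-Hall(E / N2) 'O_p^'(E / N2) ->
  p.-group E.
Proof.
move=> nN1 nN2 N12 E1 hallE1 hallE2.
have [K1 defK1 sNK1 nK1] := inv_quotientN nN1 (pcore_normal p^' (E / N1)).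
have [K2 defK2 sNK2 nK2] := inv_quotientN nN2 (pcore_normal p^' (E / N2)).
pose K := (K1 :&: K2)%G.
have sKE : K \subset E by rewrite subIset ?(normal_sub nK1).
have sK1 : K \subset K1 := subsetIl _ _; have sK2 : K \subset K2 := subsetIr _ _.
have pK1 : p^'.-group (K / N1).
  by apply: pgroupS (quotientS N1 sK1) _; rewrite /= -defK1 pcore_pgroup.
have pKN1 : p^'.-group (K :&: N1).
  have sKN1E : K :&: N1 \subset 'N(N2).
    exact: subset_trans (subsetIl K N1) (subset_trans sKE (normal_norm nN2)).
  have tiKN1 : N2 :&: (K :&: N1) = 1.
    by rewrite [LHS]setIC -[LHS]setIA N12 setIg1.
  rewrite /pgroup (card_isog (quotient_isog sKN1E tiKN1)) -pgroupE.
  apply: pgroupS (quotientS N2 (subset_trans (subsetIl K N1) sK2)) _.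
  by rewrite /= -defK2 pcore_pgroup.
have K1' : K :=: 1.
  apply/trivgP; rewrite -E1 pcore_max ?normalI //.
  rewrite /pgroup -(LagrangeI K N1) pnatM -pgroupE pKN1 /=.
  by rewrite -card_quotient // (subset_trans sKE) ?normal_norm.
apply: pgroup_p'elt => x Ex p'x; apply/set1P.
suff : x \in K by rewrite K1'.
have inK (N L : {group gT}) : N <| E -> N \subset L ->
    p^'.-Hall(E / N) 'O_p^'(E / N) -> 'O_p^'(E / N) = L / N -> x \in L.
  move=> nN sNL hallN defL; have nNx : x \in 'N(N) by rewrite (subsetP (normal_norm nN)).
  have : <[x]> / N \subset L / N.
    rewrite -defL sub_Hall_pcore ?quotientS ?cycle_subG //.
    exact: quotient_pgroup.
  by rewrite quotientSGK ?cycle_subG.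
by rewrite inE (inK N1) // (inK N2).
Qed.

(* With Q a complement of W in the preimage of 'O_p^'(E / W), 'N_P(Q) is a
   supplement of [W, Q] \subset 'Phi(P) in P, so P normalizes Q. *)
Lemma pgroup_of_Frattini (gT : finGroupType) (p : nat) (E P W : {group gT}) :
  p.-Sylow(E) P -> W <| E -> p.-group W -> [~: W, E] \subset 'Phi(P) ->
  'O_p^'(E) = 1 -> p^'.-Hall(E / W) 'O_p^'(E / W) -> p.-group E.
Proof.
move=> sylP nWE pW sWEPhi E1 hallEW; have [sPE pP _] := and3P sylP.
have sWP : W \subset P.
  by rewrite (subset_trans _ (pcore_sub_Hall sylP)) // pcore_max.
have [K defK sWK nKE] := inv_quotientN nWE (pcore_normal p^' (E / W)).
have [sKE nKEn] := andP nKE.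
have nWK : W <| K := normalS sWK sKE nWE.
have hallW : p.-Hall(K) W.
  by rewrite /pHall sWK pW -card_quotient ?normal_norm // -pgroupE -defK pcore_pgroup.
have /splitsP[Q complQ] := SchurZassenhaus_split (pHall_Hall hallW) nWK.
have [tiWQ defWQ] := complP complQ.
have hallQ : p^'.-Hall(K) Q by rewrite -(compl_pHall _ hallW).
have [sQK p'Q _] := and3P hallQ.
have nWQ : Q \subset 'N(W) := subset_trans sQK (normal_norm nWK).
have coWQ : coprime #|W| #|Q| by apply: pnat_coprime pW p'Q.
have solW := pgroup_sol pW.
(* Complements of the solvable group [W] in [K] are conjugate under [W]: a Frattini argument. *)
have sEWN : E \subset W * 'N(Q).
  apply/subsetP=> g Eg.
  have sQg : Q :^ g \subset W * Q.
    by rewrite defWQ -(normP (subsetP nKEn g Eg)) conjSg.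
  have [x Wx defQg] :=
    SchurZassenhaus_trans_sol (K1 := (Q :^ g)%G) solW nWQ sQg coWQ (cardJg _ _).
  have Ngx : g * x^-1 \in 'N(Q).
    by apply/normP; rewrite conjsgM -[Q :^ g]/(gval (Q :^ g)%G) defQg conjsgK.
  have nWNg : g * x^-1 \in 'N(W).
    by rewrite (subsetP (normal_norm nWE)) // groupM ?groupV // (subsetP (normal_sub nWE)).
  by rewrite -(mulgKV x g) conjgCV mem_mulg // memJ_norm ?groupV.
have sWQPhi : [~: W, Q] \subset 'Phi(P).
  by apply: subset_trans sWEPhi; rewrite commgS // (subset_trans sQK).
(* The [W]-part of an element of [P] splits by [W = [~: W, Q] * 'C_W(Q)]; the first factor lies in
   ['Phi(P)], the second normalizes [Q]. *)
have defP : 'Phi(P) <*> 'N_P(Q) = P.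
  apply/eqP; rewrite eqEsubset join_subG Phi_sub subsetIl /=.
  apply/subsetP=> y Py.
  have /mulsgP[x n Wx Nn defy] := subsetP sEWN y (subsetP sPE y Py).
  have Px := subsetP sWP x Wx.
  have Pn : n \in P by rewrite -(mulKg x n) -defy groupM ?groupV.
  have : x \in [~: W, Q] * 'C_W(Q) by rewrite coprime_comm_cent_mul.
  case/mulsgP=> b c Bb /setIP[Wc Cc] defx; rewrite defy defx.
  have Npn : n \in 'N_P(Q) by rewrite inE Pn.
  have Npc : c \in 'N_P(Q) by rewrite inE (subsetP sWP) //= (subsetP (cent_sub Q)).
  rewrite !groupM //; apply: mem_gen; rewrite inE ?Npn ?Npc ?orbT //.
  by rewrite (subsetP sWQPhi).
have sPN : P \subset 'N(Q).
  by move/Phi_nongen: defP; rewrite genGid => <-; apply: subsetIr.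
have nQE : Q <| E.
  rewrite /normal (subset_trans sQK sKE); apply: subset_trans sEWN _.
  by rewrite mul_subG // (subset_trans sWP).
have Q1 : Q :=: 1 by apply/trivgP; rewrite -E1 pcore_max.
have defKW : K :=: W by rewrite -defWQ Q1 mulg1.
have := p'core_Hall_pgroup _ hallEW; rewrite defK defKW trivg_quotient => /(_ erefl).
by move=> pEW; rewrite /pgroup -(Lagrange (normal_sub nWE)) pnatM -pgroupE pW /=
                       -card_quotient ?normal_norm.
Qed.

Lemma maximal_chain_quotient (gT : finGroupType) (p : nat) (G E P N : {group gT}) :
  prime p -> E <| G -> p.-Sylow(E) P -> N <| G -> N \subset E ->
  (forall M : {group gT}, maximal M P -> pi_chain p G M) ->
  forall M : {group coset_of N}, maximal M (P / N) -> pi_chain p (G / N) M.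
Proof.
move=> p_pr nEG sylP nNG sNE chP Mb maxMb; have [sPE pP _] := and3P sylP.
have sPG := subset_trans sPE (normal_sub nEG).
have nNP := subset_trans sPG (normal_norm nNG).
pose M := (P :&: coset N @*^-1 Mb)%G.
have sMP : M \subset P := subsetIl _ _.
have sNM : P :&: N \subset M by rewrite setIS ?sub_cosetpre.
have defMb : Mb = (M / N)%G.
  apply/val_inj; rewrite /= quotient_setIpre (setIidPr _) //.
  by case/andP: (maxgroupp maxMb).
have maxM : maximal M P.
  apply: p_index_maximal => //; rewrite -(index_quotient_eq sNM) //.
  have := p_maximal_index (quotient_pgroup N pP) maxMb.
  by rewrite defMb /= => ->.
rewrite defMb; apply: pi_chain_quotient => //; last exact: chP.
  exact: subset_trans sMP sPG.
move=> U nUG; exact: (Sylow_setI_mul_sub nEG sylP nNG sNE nUG sMP sNM).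
Qed.

Lemma p_nilpotent_of_maximal (gT : finGroupType) (p : nat) (G E P : {group gT}) :
  prime p -> E <| G -> p.-Sylow(E) P -> 'N_E(P) \subset P * 'C(P) ->
  (forall M : {group gT}, maximal M P -> pi_chain p G M) ->
  p^'.-Hall(E) 'O_p^'(E).
Proof.
move=> p_pr; have [n] := ubnP #|E|; elim: n => // n IHn in gT G E P *.
move=> /ltnSE-leEn nEG sylP nPcP chP; have [sPE pP _] := and3P sylP.
have [sEG nEGn] := andP nEG.
have IH (N : {group gT}) : N <| G -> N \subset E -> N :!=: 1 ->
    p^'.-Hall(E / N) 'O_p^'(E / N).
  move=> nNG sNE ntN; have nNE := normalS sNE sEG nNG.
  apply: (IHn _ (G / N)%G (E / N)%G (P / N)%G).
  - by apply: leq_trans leEn; apply: ltn_quotient.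
  - exact: quotient_normal.
  - by apply: quotient_pHall sylP; rewrite (subset_trans sPE) ?normal_norm.
  - by have := quotient_norm_Sylow sylP nPcP nNE.
  exact: maximal_chain_quotient p_pr nEG sylP nNG sNE chP.
have [E1 | ntE1] := eqVneq 'O_p^'(E) 1; last first.
  apply: p'core_Hall_quotient; apply: (IH 'O_p^'(E)%G) ntE1; rewrite ?pcore_sub //.
  exact: gFnormal_trans.
suff pE : p.-group E by rewrite E1 /pHall sub1G pgroup1 pnatNK indexg1.
have [P1 | ntP] := eqVneq (P : {set gT}) 1.
  have p'E : p^'.-group E by rewrite -partG_eq1 -(card_Hall sylP) P1 cards1.
  by rewrite -(pcore_pgroup_id p'E) E1 pgroup1.
have mchain := maximal_chain_normal p_pr nEG sylP nPcP E1.
have [P1 | [M0 maxM0 _]] := maximal_exists (sub1G P); first by rewrite -P1 eqxx in ntP.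
have [W0 [ntW0 nW0G sW0E pW0 _]] := mchain M0 maxM0 (chP M0 maxM0).
have [W minW sWW0] := minnormal_exists ntW0 (normal_norm nW0G).
have [/andP[ntW nWGn] minW'] := mingroupP minW.
have sWE := subset_trans sWW0 sW0E.
have nWG : W <| G by rewrite /normal (subset_trans sWE).
have nWE := normalS sWE sEG nWG.
have pW := pgroupS sWW0 pW0.
have hallW := IH W nWG sWE ntW.
have [sPhi | nsPhi] := boolP ([~: W, E] \subset 'Phi(P)).
  exact: pgroup_of_Frattini sylP nWE pW sPhi E1 hallW.
(* The group [W2] obtained from this [M] meets [W] trivially: otherwise [W] lies in [W2] by
   minimality, and [[~: W, E]] in [M]. *)
have [M maxM nsM] : exists2 M : {group gT}, maximal M P & ~~ ([~: W, E] \subset M).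
  apply/exists_inP; apply: contraR nsPhi; rewrite negb_exists_in => /forall_inP sM.
  apply/bigcapsP=> M /predU1P[-> | maxM].
    have sWP : W \subset P.
      by rewrite (subset_trans _ (pcore_sub_Hall sylP)) // pcore_max.
    by apply: subset_trans sWP; rewrite commg_subl normal_norm.
  by have := sM M maxM; rewrite negbK.
have [W2 [ntW2 nW2G sW2E pW2 sW2M]] := mchain M maxM (chP M maxM).
apply: (pgroup_of_TI_quotients nWE (normalS sW2E sEG nW2G) _ E1 hallW (IH W2 nW2G sW2E ntW2)).
apply/eqP; apply: contraR nsM => ntWW2.
have defW : W :&: W2 = W.
  apply: (minW' (W :&: W2)%G); rewrite ?subsetIl // ntWW2.
  by rewrite normsI // normal_norm.
by apply: subset_trans sW2M; rewrite commSg // -defW subsetIr.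
Qed.

(** * Elements of order p or 4 *)

Lemma has_Q8_sectionJ (gT : finGroupType) (X : {group gT}) e :
  has_Q8_section X -> has_Q8_section (X :^ e)%G.
Proof.
move=> QX; apply: (has_Q8_section_morphim (injm_conj (X :^ e)%G e^-1)).
rewrite (_ : _ @* _ = X)%G //.
by apply/val_inj; rewrite /= morphim_conj setIid conjsgK.
Qed.

Lemma p'elt_normal_central (gT : finGroupType) (p : nat) (E D : {group gT}) :
  D <| E -> 'O_p^'(E) = 1 ->
  {in D, forall x, p^'.-elt x -> D \subset 'C[x]} -> p.-group D.
Proof.
move=> nDE E1 cD; apply: pgroup_p'elt => x Dx p'x; apply/set1P.
have : <[x]> \subset 'O_p^'(D).
  by rewrite pcore_max // /normal cycle_subG Dx cents_norm // cent_cycle cD.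
by rewrite -(pcore_setI_normal _ nDE) E1 setI1g cycle_subG.
Qed.

(** For a group [A] these elements generate O^p(A), the smallest normal subgroup with quotient a
    p-group. *)
Definition p'_elements (gT : finGroupType) (p : nat) (A : {set gT}) := [set x in A | p^'.-elt x].

Lemma p'_elements_norm (gT : finGroupType) (p : nat) (A B : {set gT}) :
  B \subset 'N(A) -> B \subset 'N(<<p'_elements p A>>).
Proof.
move=> nAB; rewrite norms_gen //; apply/subsetP=> b Bb; rewrite inE.
apply/subsetP=> _ /imsetP[x + ->]; rewrite !inE p_eltJ => /andP[Ax ->].
by rewrite memJ_norm ?(subsetP nAB) ?Ax.
Qed.

Section SmallElements.

Variables (gT : finGroupType) (p : nat) (G E P : {group gT}).
Hypotheses (p_pr : prime p) (nEG : E <| G) (sylP : p.-Sylow(E) P).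
Hypotheses (nPcP : 'N_E(P) \subset P * 'C(P)) (E1 : 'O_p^'(E) = 1).
Hypothesis chP : {in P, forall x, small_elt P x -> pi_chain p G <[x]>}.

Let sPE : P \subset E := pHall_sub sylP.
Let pP : p.-group P := pHall_pgroup sylP.
Let sEG : E \subset G := normal_sub nEG.

Let O := <<p'_elements p E>>%G.

Let sOE : O \subset E.
Proof. by rewrite gen_subG; apply/subsetP=> x; rewrite inE => /andP[]. Qed.

Let nOG : G \subset 'N(O).
Proof. exact: p'_elements_norm (normal_norm nEG). Qed.

Variable K : {group gT}.
Hypotheses (nKG : K <| G) (sKE : K \subset E) (ncKO : ~~ (K \subset 'C(O))).
Hypothesis minK : forall L : {group gT}, L <| G -> L \subset K ->
  L :!=: K -> L \subset 'C(O).

(** By minimality of [K], every normal subgroup of [G] properly contained in [K] lies in [N]. *)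
Let N := (K :&: 'C(O))%G.
Let sKG := normal_sub nKG.
Let nKGn := normal_norm nKG.
Let nKE : K <| E := normalS sKE sEG nKG.

Let nNG : N <| G.
Proof.
rewrite /normal subIset ?(normal_sub nKG) //.
by rewrite normsI ?norms_cent // normal_norm.
Qed.

Let sNK : N \subset K := subsetIl _ _.
Let nNE : N <| E := normalS (subset_trans sNK sKE) sEG nNG.
Let nNK : N <| K := normalS sNK sKG nNG.

Let p'O x : x \in E -> p^'.-elt x -> x \in O.
Proof. by move=> Ex p'x; rewrite mem_gen // inE Ex. Qed.

Let pN : p.-group N.
Proof.
apply: (p'elt_normal_central nNE E1) => x Nx p'x.
rewrite -cent_set1 (subset_trans (subsetIr K _)) // centS // sub1set.
by rewrite p'O // (subsetP (normal_sub nNE)).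
Qed.

Let min_sub (L : {group gT}) : L <| G -> L \subset K -> L :!=: K -> L \subset N.
Proof. by move=> nLG sLK neLK; rewrite subsetI sLK minK. Qed.

(** At the step where [x] enters the chain, minimality of [K] gives [K \subset V] and [K :&: U = N];
    intersecting with [K] carries the information on [V / U] over to [K / N]. *)
Lemma minimal_step x : x \in K -> x \in P -> x \notin N -> small_elt P x ->
  p.-nat #|K : N| /\ p.-nat #|G : 'N_G(<[x]> * N)|.
Proof.
move=> Kx Px Nx sx; have [||U [V [stUV Ux Vx]]] := @chP x Px sx (fun U : {group gT} => x \in U).
- by apply: contra Nx => /set1P->.
- by rewrite (subsetP sKG).
have [nUG nVG sUV chUV [pUV pNx]] := stUV.
have sKV : K \subset V.
  apply: contraR Nx => nsKV.
  have nKVG : K :&: V <| G by rewrite normalI.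
  apply: (subsetP (min_sub nKVG (subsetIl _ _) _)); last by rewrite inE Kx.
  by apply: contraNneq nsKV => /= <-; rewrite subsetIr.
have sKUN : K :&: U \subset N.
  apply: (min_sub (normalI nKG nUG) (subsetIl _ _)).
  by apply: contraNneq Ux => /= KU; move: Kx; rewrite -KU inE => /andP[].
have nNU : U \subset 'N(N) := subset_trans (normal_sub nUG) (normal_norm nNG).
(* [U <*> N] is [U] or [V]; if it is [V], Dedekind's law puts [x] in [(K :&: U) * N = N]. *)
have sNU : N \subset U.
  have nUNG : U <*> N <| G by rewrite normalY.
  have [||defU | defV] := chUV _ nUNG; rewrite ?joing_subl //.
  - by rewrite join_subG sUV (subset_trans sNK).
  - by rewrite -defU joing_subr.
  case/negP: Nx; have : x \in (U * N) :&: K.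
    by rewrite inE Kx andbT -norm_joinEl // defV.
  rewrite normC // -group_modl // setIC => /(subsetP _)-> //.
  by rewrite mul_subG // setIC.
have defN : N :=: K :&: U.
  by apply/eqP; rewrite eqEsubset sKUN subsetI sNK sNU.
have xV : <[x]> :&: V = <[x]> by apply/setIidPl; rewrite cycle_subG.
rewrite xV in pUV pNx; split.
  case: pUV => [|pUV]; first by rewrite cycle_subG (negPf Ux).
  rewrite defN indexgI; apply: pnat_dvd pUV; apply: dvdn_index_norm => //.
  exact: subset_trans (normal_sub nUG) nKGn.
apply: pnat_dvd pNx; apply: indexgS; rewrite subsetI subsetIl /=.
apply/subsetP=> g /setIP[Gg Ng].
have -> : <[x]> * N = (<[x]> * U) :&: K.
  by rewrite -group_modl ?cycle_subG // setIC defN.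
rewrite inE conjIg (normP Ng); apply: setIS.
by rewrite (normP (subsetP nKGn g Gg)).
Qed.

Lemma minimal_pgroup : p.-group K.
Proof.
apply: contraT => npK.
(* A small element outside [N] would make [K / N], and with it [K], a p-group. *)
have smallN x : x \in K -> p.-elt x -> small_elt P x -> x \in N.
  move=> Kx px sx; apply: contraR npK => Nx.
  have [e Ee] : exists2 e, e \in E & <[x]> :^ e \subset P.
    by apply: (Sylow_Jsub sylP _ px); rewrite cycle_subG (subsetP sKE).
  rewrite -cycleJ cycle_subG => Pxe.
  have [|//||pKN _] := @minimal_step (x ^ e) _ Pxe.
  - by rewrite memJ_norm // (subsetP nKGn) // (subsetP sEG).
  - by rewrite memJ_norm // (subsetP (normal_norm nNE)).
  - by rewrite small_eltJ.
  by rewrite /pgroup -(Lagrange sNK) pnatM -pgroupE pN.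
have K1 : 'O_p^'(K) = 1 by rewrite -(pcore_setI_normal _ nKE) E1 setI1g.
(* If the p'-elements of [K] generated a proper subgroup, it would lie in the p-group [N], and [K]
   would be a p-group. *)
have sKO : K \subset O.
  have nLG : <<p'_elements p K>> <| G.
    rewrite /normal p'_elements_norm // andbT (subset_trans _ sKG) // gen_subG.
    by apply/subsetP=> x; rewrite inE => /andP[].
  have sLK : <<p'_elements p K>> \subset K.
    by rewrite gen_subG; apply/subsetP=> x; rewrite inE => /andP[].
  have [<- | neLK] := eqVneq <<p'_elements p K>> (K : {set gT}).
    by apply: genS; apply/subsetP=> x; rewrite !inE => /andP[/(subsetP sKE)-> ->].
  case/negP: npK; have sLN := min_sub nLG sLK neLK.
  apply: pgroup_p'elt => x Kx p'x.
  have Nx : x \in N by rewrite (subsetP sLN) // mem_gen // inE Kx.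
  by apply/eqP; rewrite -order_eq1 (pnat_1 (mem_p_elt pN Nx) p'x).
have cNK : K \subset 'C(N).
  by rewrite centsC; apply: subset_trans (subsetIr _ _) (centS sKO).
have K' : K^`(1) = K.
  apply/eqP; apply: contraR npK => neK.
  have nK'G : K^`(1) <| G by apply: gFnormal_trans.
  have sK'N := min_sub nK'G (der_sub 1 K) neK.
  have nilK : nilpotent K.
    apply: small_nil_class; apply: (@leq_trans 2) => //.
    rewrite nil_class2 subsetI der_sub (subset_trans sK'N) //.
    by rewrite centsC.
  have := nilpotent_pcoreC p nilK; rewrite K1 dprodg1 => <-.
  exact: pcore_pgroup.
have [R sylR] := Sylow_exists p K.
(* Small elements of [K] lie in the central subgroup [N], so p'-subgroups of [K] fix them, and
   Frobenius' criterion applies to the perfect group [K]. *)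
have R1 : R :=: 1.
  apply: perfect_Sylow_trivial sylR K' => X A sXK pX sAX p'A.
  move: sAX; rewrite subsetI => /andP[sAK nXA].
  apply: (p'_centralizes_of_small p_pr pX p'A nXA) => x Xx sx.
  have sXE := subset_trans sXK sKE.
  have [e Ee sXeP] := Sylow_Jsub sylP sXE pX.
  have Kx := subsetP sXK x Xx; have px := mem_p_elt pX Xx.
  have sPx : small_elt P x.
    case/orP: sx => [ox | /andP[ox /(has_Q8_sectionJ e) Q]].
      by rewrite /small_elt ox.
    by rewrite /small_elt ox (has_Q8_sectionS _ Q) ?orbT.
  rewrite (subset_trans sAK) // -cent_set1 (subset_trans cNK) // centS //.
  by rewrite sub1set smallN.
have p'K : p^'.-group K by rewrite -partG_eq1 -(card_Hall sylR) R1 cards1.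
by case/negP: ncKO; rewrite -(pcore_pgroup_id p'K) K1 sub1G.
Qed.

Lemma minimal_absurd : False.
Proof.
have pK := minimal_pgroup.
have sKP : K \subset P.
  by rewrite (subset_trans _ (pcore_sub_Hall sylP)) // pcore_max.
have nKO : O \subset 'N(K) := subset_trans sOE (normal_norm nKE).
have nsKN : ~~ (K \subset N) by rewrite subsetI subxx.
(* Otherwise [O] centralizes [[~: K, O]], and by coprime action each p'-element of [E] centralizes
   [K]. *)
have KOK : [~: K, O] = K.
  apply/eqP; apply: contraR ncKO => neKO.
  have sRK : [~: K, O] \subset K by rewrite commg_subl.
  have nRG : [~: K, O] <| G.
    by rewrite /normal (subset_trans sRK) // normsR.
  have cRO := minK nRG sRK neKO.
  rewrite centsC gen_subG; apply/subsetP=> x; rewrite inE => /andP[Ex p'x].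
  have Ox := p'O Ex p'x; rewrite -cycle_subG.
  have sxO : <[x]> \subset O by rewrite cycle_subG.
  apply: (coprime_comm_centralized _ _ (pgroup_sol pK)).
  - exact: subset_trans nKO.
  - exact: pnat_coprime pK p'x.
  rewrite centsC; apply: subset_trans (commgS K sxO) _.
  exact: subset_trans cRO (centS sxO).
have ntK : K :!=: 1 by apply: contraNneq ncKO => ->; apply: sub1G.
have sPhiN : 'Phi(K) \subset N.
  apply: min_sub; rewrite ?Phi_sub //; first exact: gFnormal_trans.
  by have := Phi_proper ntK; rewrite properEneq => /andP[].
have cPhi : O \subset 'C('Phi(K)).
  by rewrite centsC (subset_trans sPhiN) // subsetIr.
have small := small_elt_of_action p_pr pK nKO KOK cPhi.
have [S sylS] := Sylow_exists p G; have [sSG pS _] := and3P sylS.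
have sKS : K \subset S.
  by rewrite (subset_trans _ (pcore_sub_Hall sylS)) // pcore_max.
have nKS : K <| S := normalS sKS sSG nKG.
have nNS : S \subset 'N(N) := subset_trans sSG (normal_norm nNG).
have ntKN : K / N != 1.
  by rewrite quotient_neq1 // properE sNK.
have := meet_center_nil (pgroup_nil (quotient_pgroup N pS))
          (quotient_normal N nKS) ntKN.
case/trivgPn=> xb /setIP[/morphimP[x Nx Kx ->] /setIP[_ cSx]] ntx.
have N'x : x \notin N by apply: contra ntx => /coset_id/eqP.
have x1 : x != 1 by apply: contraNneq N'x => ->.
have Px := subsetP sKP x Kx.
have [_ pNx] := minimal_step Kx Px N'x (small_eltS sKP (small x Kx x1)).
have nxN : <[x]> \subset 'N(N) by rewrite cycle_subG.
have defX : <[x]> * N = coset N @*^-1 (<[x]> / N) by rewrite quotientK // normC.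
(* The coset of [x] is central in [S / N], so [S] normalizes [<[x]> * N]; its normalizer also has
   p-power index, hence is all of [G]. *)
have nXG : G \subset 'N(<[x]> * N).
  apply: (norm_of_p_index (normal_refl G) sylS) pNx.
  rewrite defX norm_quotient_pre // quotient_cycle // cents_norm //.
  by rewrite centsC cycle_subG.
have sXK : <[x]> <*> N \subset K by rewrite join_subG cycle_subG Kx.
have defK : <[x]> <*> N = K.
  apply/eqP; apply: contraR N'x => neXK.
  have nLG : <[x]> <*> N <| G.
    by rewrite /normal (subset_trans sXK) // norm_joinEl.
  have := min_sub nLG sXK neXK.
  by rewrite join_subG cycle_subG => /andP[].
have iKN : #|K : N| = p.
  rewrite -card_quotient ?normal_norm // -defK quotientYidr // quotient_cycle //.
  apply: nt_prime_order => //.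
  have xpN : x ^+ p \in N by rewrite (subsetP sPhiN) // (Phi_pX pK).
  exact: etrans (esym (morphX _ p Nx)) (coset_id xpN).
have sKEN := prime_section_central sylP nPcP p_pr nNE nKE sNK iKN.
case/negP: nsKN; rewrite -{1}KOK.
exact: subset_trans (commgS K sOE) sKEN.
Qed.

End SmallElements.

Lemma pgroup_of_small (gT : finGroupType) (p : nat) (G E P : {group gT}) :
  prime p -> E <| G -> p.-Sylow(E) P -> 'N_E(P) \subset P * 'C(P) ->
  'O_p^'(E) = 1 -> {in P, forall x, small_elt P x -> pi_chain p G <[x]>} ->
  p.-group E.
Proof.
move=> p_pr nEG sylP nPcP E1 chP; pose O := <<p'_elements p E>>%G.
have [cEO | ncEO] := boolP (E \subset 'C(O)).
  apply: (p'elt_normal_central (normal_refl E) E1) => x Ex p'x.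
  rewrite -cent_set1 (subset_trans cEO) // centS // sub1set mem_gen //.
  by rewrite inE Ex.
have [K minK _] := @mingroup_exists _ (fun K : {group gT} =>
  [&& K <| G, K \subset E & ~~ (K \subset 'C(O))]) E
  (introT and3P (And3 nEG (subxx E) ncEO)).
have [/and3P[nKG sKE ncKO] min'] := mingroupP minK.
case: (minimal_absurd p_pr nEG sylP nPcP E1 chP nKG sKE ncKO) => L nLG sLK.
apply: contraR => ncLO; apply/eqP/min' => //.
by rewrite nLG ncLO (subset_trans sLK).
Qed.

(** Passing to [E / 'O_p^'(E)] maps [P] isomorphically, so small elements of the image come from
    small elements of [P], and [P :&: N = 1] lets their chains descend. *)
Lemma p_nilpotent_of_small (gT : finGroupType) (p : nat) (G E P : {group gT}) :
  prime p -> E <| G -> p.-Sylow(E) P -> 'N_E(P) \subset P * 'C(P) ->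
  {in P, forall x, small_elt P x -> pi_chain p G <[x]>} ->
  p^'.-Hall(E) 'O_p^'(E).
Proof.
move=> p_pr nEG sylP nPcP chP; have [sPE pP _] := and3P sylP.
pose N := 'O_p^'(E)%G.
have nNE : N <| E := pcore_normal _ _.
have nNG : N <| G by apply: gFnormal_trans.
have nNP : P \subset 'N(N) := subset_trans sPE (normal_norm nNE).
have tiPN : P :&: N = 1 by apply: coprime_TIg; apply: pnat_coprime pP (pcore_pgroup _ _).
pose f := [morphism of restrm nNP (coset N)].
have injf : 'injm f by rewrite ker_restrm ker_coset tiPN.
have fP : (f @* P)%G = (P / N)%G.
  by apply/val_inj; rewrite /= morphim_restrm setIid.
suff pEN : p.-group (E / N).
  rewrite /pHall pcore_sub pcore_pgroup pnatNK -card_quotient //.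
  exact: gFnorm.
apply: (@pgroup_of_small _ p (G / N)%G (E / N)%G (P / N)%G) => //.
- exact: quotient_normal.
- exact: quotient_pHall sylP.
- by have := quotient_norm_Sylow sylP nPcP nNE.
- exact: trivg_pcore_quotient.
move=> _ /morphimP[x Nx Px ->] sx.
have ox : #[coset N x] = #[x] by apply: (order_injm injf).
have -> : <[coset N x]>%G = (<[x]> / N)%G.
  by apply/val_inj; rewrite /= quotient_cycle.
have sxP : <[x]> \subset P by rewrite cycle_subG.
apply: pi_chain_quotient => //.
- by rewrite (subset_trans sxP) // (subset_trans sPE) ?normal_sub.
- move=> W nWG; apply: (Sylow_setI_mul_sub nEG sylP nNG (pcore_sub _ _) nWG sxP).
  by rewrite tiPN sub1G.
apply: chP => //; move: sx; rewrite /small_elt ox => /orP[-> // | /andP[-> Q]].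
by rewrite (has_Q8_section_morphim injf) ?orbT // fP.
Qed.

(** * From the Sylow normalizer to the whole group *)

Lemma p_nilpotent_norm_Sylow (gT : finGroupType) (p : nat) (G E P : {group gT}) :
  E <| G -> p.-Sylow(E) P -> p_nilpotent p 'N_G(P)%G ->
  'N_E(P) \subset P * 'C(P).
Proof.
move=> nEG sylP [K [nKN hallK]]; have [sPE pP _] := and3P sylP.
have sPN : P \subset 'N_G(P) by rewrite subsetI normG (subset_trans sPE) ?normal_sub.
(* [P] and the p-complement [K] are normal subgroups of coprime orders in ['N_G(P)]. *)
have cKP : K \subset 'C(P).
  have p'K := pHall_pgroup hallK.
  apply/commG1P/trivgP; rewrite -(coprime_TIg (pnat_coprime pP p'K)) setIC.
  rewrite commg_subI // subsetI subxx /=; last first.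
    exact: subset_trans sPN (normal_norm nKN).
  exact: subset_trans (normal_sub nKN) (subsetIr _ _).
apply/subsetP=> g Ng; have [Eg NPg] := setIP Ng.
have NGg : g \in 'N_G(P) by rewrite inE NPg (subsetP (normal_sub nEG)).
rewrite -(consttC p g) mem_mulg //.
  rewrite (mem_normal_Hall (_ : p.-Sylow('N_E(P)) P)) ?Sylow_subnorm //.
  - exact: p_elt_constt.
  - by rewrite /normal subsetI sPE normG subsetIr.
  exact: groupX.
rewrite (subsetP cKP) // (mem_normal_Hall hallK nKN) ?groupX //.
exact: p_elt_constt.
Qed.

(** As [E = 'O_p^'(E) * P], Frattini gives [G = 'O_p^'(E) * 'N_G(P)]; the p-complement of ['N_G(P)]
    times ['O_p^'(E)] is a normal p-complement of [G]. *)
Lemma p_nilpotent_Frattini (gT : finGroupType) (p : nat) (G E P : {group gT}) :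
  E <| G -> p.-Sylow(E) P -> p^'.-Hall(E) 'O_p^'(E) ->
  p_nilpotent p 'N_G(P)%G -> p_nilpotent p G.
Proof.
move=> nEG sylP hallE [K [nKN hallK]]; pose N := 'O_p^'(E)%G.
have nNG : N <| G by apply: gFnormal_trans.
have /(sdprod_Hall_p'coreP hallE)/sdprodP[_ defE _ _] := sylP.
have defG : N * 'N_G(P) = G.
  rewrite -[RHS](Frattini_arg nEG sylP) -defE -mulgA; congr (_ * _).
  rewrite mulSGid // subsetI normG andbT.
  by rewrite (subset_trans (pHall_sub sylP)) ?normal_sub.
have nNN : 'N_G(P) \subset 'N(N) := subset_trans (subsetIl _ _) (normal_norm nNG).
have defGN : G / N = 'N_G(P) / N by rewrite -[in LHS]defG quotientMidl.
have nNK : K \subset 'N(N) := subset_trans (normal_sub nKN) nNN.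
have nNKG : N <*> K <| G.
  rewrite -(quotientGK nNG) -(quotientYK nNK) cosetpre_normal defGN.
  exact: quotient_normal.
exists (N <*> K)%G; split=> //.
have nNNK : N <| N <*> K by rewrite /normal joing_subl join_subG normG.
have p'N : p^'.-group N := pcore_pgroup _ _.
rewrite -(pquotient_pHall p'N nNG nNNK) /= quotientYidl // defGN.
exact: quotient_pHall hallK.
Qed.

Theorem corollary1p8 (p : nat) (gT : finGroupType) (G E : {group gT})
    (F : group_class) :
  prime p ->
  formation F ->
  class_sub (p_nilpotent p) F ->
  class_eq (class_mul (p'_groups p) F) F ->
  E <| G ->
  F _ (G / E)%G ->
  (forall P : {group gT}, p.-Sylow(E) P ->
     p_nilpotent p 'N_G(P)%G /\
     ((forall M : {group gT}, maximal M P -> partial_Pi G M) \/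
      (forall C : {group gT}, C \subset P -> cyclic C ->
         prime #|C| \/ (#|C| = 4 /\ ~ quaternion_free P) ->
         partial_Pi G C))) ->
  F gT G.
Proof.
move=> p_pr _ sNF _ nEG _ hP; have [P sylP] := Sylow_exists p E.
have [sPE pP _] := and3P sylP; have [nilN hMC] := hP P sylP.
have sPG := subset_trans sPE (normal_sub nEG).
have nPcP := p_nilpotent_norm_Sylow nEG sylP nilN.
apply: sNF; apply: (p_nilpotent_Frattini nEG sylP _ nilN).
case: hMC => [hM | hC].
  apply: (p_nilpotent_of_maximal p_pr nEG sylP nPcP) => M maxM.
  have [sMP _] := andP (maxgroupp maxM).
  apply: partial_Pi_chain (pgroupS sMP pP) _ (hM M maxM) => //.
  exact: subset_trans sMP sPG.
apply: (p_nilpotent_of_small p_pr nEG sylP nPcP) => x Px sx.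
have sxP : <[x]> \subset P by rewrite cycle_subG.
apply: partial_Pi_chain (pgroupS sxP pP) (subset_trans sxP sPG) _ => //.
apply: hC (cycle_cyclic x) _ => //.
case/orP: sx => [ox | /andP[/eqP ox Q]]; [by left | right; split=> //].
by move/quaternion_freeP; rewrite Q.
Qed.
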